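(* Consider longitudinal data $Z = (X_1, A_1, \dots, X_T, A_T, Y)$ generated by the nonparametric structural equation model and counterfactuals described in the context, and suppose strong sequential randomization holds: $U_{A,t} \perp \{\underline U_{X,t+1}, \underline U_{A,t+1}, U_Y\} \mid H_t$ for all $t \le T$. Fix a target regime $\overline a_T = (a_1,\dots,a_T) \in \{0,1\}^T$ and weight functions $f_t$ mapping histories $h_t$ to $[0,1]$, $t=1,\dots,T$, and let $\overline D_{\overline f}(\overline a_T)$ be the sequence of longitudinal flip interventions targeting $\overline a_T$ (defined in the context). Suppose that, for every $t$, either (1) $\mathbb{P}\{\mathbb{P}(A_t = a_t \mid H_t) = 0 \implies f_t(H_t) = 0\} = 1$, or (2) $\mathbb{P}\{\mathbb{P}(A_t = a_t \mid H_t) = 0\} = 0$. Define $Q_t(a_t \mid h_t) = \mathbb{P}(A_t = a_t \mid h_t) + f_t(h_t)\{1 - \mathbb{P}(A_t = a_t \mid h_t)\}$ and $Q_t(1-a_t \mid h_t) = 1 - Q_t(a_t \mid h_t)$. Then \[ \mathbb{E}\big[Y\{\overline D_{\overline f}(\overline a_T)\}\big] = \sum_{\overline b_T \in \{0,1\}^T} \int \mathbb{E}(Y \mid \overline A_T = \overline b_T, \overline X_T = \overline x_T) \prod_{t=1}^T Q_t(b_t \mid \overline b_{t-1}, \overline x_t)\, d\mathbb{P}(x_t \mid \overline b_{t-1}, \overline x_{t-1}) = \mathbb{E}\Big[ Y \prod_{t=1}^T \frac{Q_t(A_t \mid H_t)}{\mathbb{P}(A_t \mid H_t)}\Big], \]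 and, for each $t \le T$, \[ \mathbb{E}\{D_{f_t}(a_t)\} = \sum_{\overline b_{t-1} \in \{0,1\}^{t-1}} \int Q_t(1 \mid \overline b_{t-1}, \overline x_t)\, d\mathbb{P}(x_t \mid \overline b_{t-1}, \overline x_{t-1}) \prod_{s=1}^{t-1} Q_s(b_s \mid \overline b_{s-1}, \overline x_s)\, d\mathbb{P}(x_s \mid \overline b_{s-1}, \overline x_{s-1}) = \mathbb{E}\Big[ Q_t(1 \mid H_t) \prod_{s=1}^{t-1} \frac{Q_s(A_s \mid H_s)}{\mathbb{P}(A_s \mid H_s)}\Big], \] where $D_{f_t}(a_t)$ is the time-$t$ component of $\overline D_{\overline f}(\overline a_T)$.
   Context: Data: $X_t \in \mathbb{R}^d$ time-varying covariates, $A_t \in \{0,1\}$ binary treatments, $Y\in\mathbb{R}$ final outcome. For a time-varying variable $O_t$, $\overline O_t = (O_1,\dots,O_t)$ and $\underline O_t = (O_t,\dots,O_T)$. $H_t = (\overline X_t, \overline A_{t-1})$ is the history before treatment at time $t$; $\mathbb{P}(A_t \mid H_t)$ denotes $\mathbb{P}(A_t = b \mid H_t)$ evaluated at $b = A_t$, and similarly $Q_t(A_t\mid H_t)$. Structural model: there are deterministic functions with $X_t = f_{X,t}(A_{t-1}, H_{t-1}, U_{X,t})$, $A_t = f_{A,t}(H_t, U_{A,t})$, $Y = f_Y(A_T, H_T, U_Y)$, for exogenous variables $U_{X,t}, U_{A,t}, U_Y$. An intervention replaces the equation for $A_t$ by an assigned value $D_t$. Under interventions $\overline D_{t-1}$ up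 to time $t-1$, counterfactuals are $X_t(\overline D_{t-1}) = f_{X,t}\{D_{t-1}, H_{t-1}(\overline D_{t-2}), U_{X,t}\}$, $A_t(\overline D_{t-1}) = f_{A,t}\{H_t(\overline D_{t-1}), U_{A,t}\}$ (the natural value of treatment), with $H_t(\overline D_{t-1}) = \{\overline D_{t-1}, \overline X_t(\overline D_{t-1})\}$, $A_1(D_0)=A_1$, $X_1(D_0)=X_1$; and $Y(\overline D_T) = f_Y\{D_T, H_T(\overline D_{T-1}), U_Y\}$. Consistency is implicit in this model. Flip interventions: let $V_1,\dots,V_T$ be iid $\mathrm{Unif}(0,1)$, independent of all other variables in the model. Recursively, with $\overline D_{t-1} = (D_{f_1}(a_1),\dots,D_{f_{t-1}}(a_{t-1}))$, set $D_{f_t}(a_t) = A_t(\overline D_{t-1})$ if $A_t(\overline D_{t-1}) = a_t$, and otherwise $D_{f_t}(a_t) = a_t \mathbf{1}[V_t \le f_t\{H_t(\overline D_{t-1})\}] + A_t(\overline D_{t-1})\mathbf{1}[V_t > f_t\{H_t(\overline D_{t-1})\}]$. That is, a subject whose natural treatment equals the target is left alone, and otherwise is flipped to the target with probability $f_t$ of its counterfactual history. $\overline D_{\overline f}(\overline a_T) = (D_{f_1}(a_1), \dots, D_{f_T}(a_T))$. *)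

(* Defs.v *)
From HB Require Import structures.
From mathcomp Require Import all_boot all_order all_algebra.
From mathcomp Require Import all_classical all_reals all_analysis.

Set Implicit Arguments.
Unset Strict Implicit.
Unset Printing Implicit Defensive.

Import Order.TTheory GRing.Theory Num.Theory.

Local Open Scope classical_set_scope.
Local Open Scope ring_scope.

(* Conventions.  Time is 0-based: t = 0, ..., T-1 (the paper's 1, ..., T).  *)
(* Covariates X_t live in R^d, represented as d.-tuple R.  A (full) history *)
(* is a pair (xs, as) of a T-tuple of covariates and a T-tuple of binary    *)
(* treatments.  A partial history such as H_t = (x_0..x_t, a_0..a_{t-1}) is *)
(* represented by the full-length pair in which all not-yet-observed        *)
(* entries are replaced by fixed defaults (the zero vector / false).        *)

Section Histories.
Context (R : realType) (d T : nat).

Definition Xcov := (d.-tuple R).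
Definition Hist := (T.-tuple Xcov * T.-tuple bool)%type.

Definition xdef : Xcov := [tuple (0 : R) | _ < d].

Definition hist0 : Hist := ([tuple xdef | _ < T], [tuple false | _ < T]).

Definition trunc (nx na : nat) (h : Hist) : Hist :=
  ([tuple if (i < nx)%N then tnth h.1 i else xdef | i < T],
   [tuple if (i < na)%N then tnth h.2 i else false | i < T]).

Definition setXh (n : nat) (x : Xcov) (h : Hist) : Hist :=
  ([tuple if (i == n :> nat) then x else tnth h.1 i | i < T], h.2).

Definition setAh (n : nat) (b : bool) (h : Hist) : Hist :=
  (h.1, [tuple if (i == n :> nat) then b else tnth h.2 i | i < T]).

Definition Xof (t : nat) (h : Hist) : Xcov := nth xdef h.1 t.
Definition Aof (t : nat) (h : Hist) : bool := nth false h.2 t.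

(* H_t : history before treatment at time t *)
Definition histA (t : nat) (h : Hist) : Hist := trunc t.+1 t h.
(* (A_{t-1}, H_{t-1}) : history before covariate at time t *)
Definition histX (t : nat) (h : Hist) : Hist := trunc t t h.

(* Recursive generation of a trajectory from the structural equations:
   gX t (A_{t-1}, H_{t-1}) gives X_t and gA t H_t gives A_t.
   [traj gX gA k] has generated times 0 .. k-1. *)
Fixpoint traj (gX : nat -> Hist -> Xcov) (gA : nat -> Hist -> bool)
    (k : nat) : Hist :=
  match k with
  | 0 => hist0
  | k'.+1 =>
      let h := traj gX gA k' in
      let h1 := setXh k' (gX k' (histX k' h)) h in
      setAh k' (gA k' (histA k' h1)) h1
  end.

End Histories.

Arguments hist0 {R d T}.

Section Model.
Context (R : realType) (d T : nat).
Context (dO : measure_display) (Omega : measurableType dO).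
Context (dX dA : nat -> measure_display) (dY : measure_display)
        (UXT : forall t, measurableType (dX t))
        (UAT : forall t, measurableType (dA t))
        (UYT : measurableType dY).

Variables (fX : forall t, (Hist R d T * UXT t)%type -> Xcov R d)
          (fA : forall t, (Hist R d T * UAT t)%type -> bool)
          (fY : (Hist R d T * UYT)%type -> R).
Variables (UX : forall t, Omega -> UXT t) (UA : forall t, Omega -> UAT t)
          (UY : Omega -> UYT).

Definition obs (w : Omega) : Hist R d T :=
  traj (fun t h => @fX t (h, @UX t w)) (fun t h => @fA t (h, @UA t w)) T.

Definition Yobs (w : Omega) : R := fY (obs w, UY w).

Definition Aobs (t : nat) (w : Omega) : bool := Aof t (obs w).

Definition Hobs (t : nat) (w : Omega) : Hist R d T := histA t (obs w).

Definition HXobs (t : nat) (w : Omega) : Hist R d T := histX t (obs w).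

(* Longitudinal flip intervention targeting a, with weight functions ff
   and auxiliary uniforms V. The natural value of treatment at time t is
   @fA t (H_t(D_{t-1}), U_{A,t}). *)
Variables (V : nat -> Omega -> R) (a : nat -> bool)
          (ff : nat -> Hist R d T -> R).

Definition flip_traj (w : Omega) : Hist R d T :=
  traj (fun t h => @fX t (h, @UX t w))
       (fun t h => let nat_t := @fA t (h, @UA t w) in
                   if nat_t == a t then nat_t
                   else if V t w <= ff t h then a t else nat_t) T.

Definition Yflip (w : Omega) : R := fY (flip_traj w, UY w).

Definition Dflip (t : nat) (w : Omega) : bool := Aof t (flip_traj w).

Definition allU_events : set (set Omega) :=
  [set E | (exists s (B : set (UXT s)), (s < T)%N /\ measurable B /\ E = @UX s @^-1` B)
        \/ (exists s (B : set (UAT s)), (s < T)%N /\ measurable B /\ E = @UA s @^-1` B)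
        \/ (exists B, measurable B /\ E = UY @^-1` B)].

Definition futureU_events (t : nat) : set (set Omega) :=
  [set E | (exists s (B : set (UXT s)), (t < s < T)%N /\ measurable B /\ E = @UX s @^-1` B)
        \/ (exists s (B : set (UAT s)), (t < s < T)%N /\ measurable B /\ E = @UA s @^-1` B)
        \/ (exists B, measurable B /\ E = UY @^-1` B)].

End Model.

Section Conditioning.
Context (R : realType) (dO : measure_display) (Omega : measurableType dO).
Context (P : probability Omega R).

Definition isCondExp (dC : measure_display) (TC : measurableType dC)
    (Z : Omega -> R) (C : Omega -> TC) (phi : TC -> R) : Prop :=
  measurable_fun setT phi /\
  forall B : set TC, measurable B ->
    (\int[P]_(w in C @^-1` B) (Z w)%:E = \int[P]_(w in C @^-1` B) (phi (C w))%:E)%E.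

Definition condIndep (d1 : measure_display) (T1 : measurableType d1)
    (dC : measure_display) (TC : measurableType dC)
    (Z : Omega -> T1) (G : set (set Omega)) (C : Omega -> TC) : Prop :=
  forall S : set T1, measurable S ->
  forall E : set Omega, <<s G >> E ->
  exists phi1 phi2 : TC -> R,
    [/\ isCondExp (\1_(Z @^-1` S)) C phi1,
         isCondExp (\1_E) C phi2 &
         isCondExp (\1_(Z @^-1` S `&` E)) C (phi1 \* phi2)].

End Conditioning.

Section Gformula.
Context (R : realType) (d T : nat).

(* Q_t(b | h) built from a version pi_t(h) of P(A_t = a_t | H_t = h):
   Q_t(a_t | h) = pi_t(h) + f_t(h) (1 - pi_t(h)),  Q_t(1 - a_t | h) = 1 - Q_t(a_t | h). *)
Definition Qw (a : nat -> bool) (ff pi : nat -> Hist R d T -> R)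
    (t : nat) (b : bool) (h : Hist R d T) : R :=
  let qa := pi t h + ff t h * (1 - pi t h) in
  if b == a t then qa else 1 - qa.

(* P(A_t = b | H_t = h), from the version pi_t of P(A_t = a_t | H_t) *)
Definition propw (a : nat -> bool) (pi : nat -> Hist R d T -> R)
    (t : nat) (b : bool) (h : Hist R d T) : R :=
  if b == a t then pi t h else 1 - pi t h.

(* Iterated integral
   int ... int F(b_0..b_{n+k-1}, x_0..x_{n+k-1})
      prod_{s=n}^{n+k-1} Q_s(b_s | b_{<s}, x_{<=s}) dP(x_s | b_{<s}, x_{<s}),
   where kappa s is (a version of) the conditional law of X_s given
   (A_{s-1}, H_{s-1}), and h holds the already fixed b_{<n}, x_{<n}. *)
Fixpoint gint (kappa : nat -> R.-pker (Hist R d T) ~> (Xcov R d))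
    (Q : nat -> bool -> Hist R d T -> R) (b : nat -> bool)
    (F : Hist R d T -> \bar R) (k n : nat) (h : Hist R d T) : \bar R :=
  match k with
  | 0 => F h
  | k'.+1 =>
      (\int[kappa n h]_x
         ((Q n (b n) (setXh n x h))%:E *
          gint kappa Q b F k' n.+1 (setAh n (b n) (setXh n x h))))%E
  end.

End Gformula.

(* Main.v *)
(* Idea.  Write Q_t / P_t for the ratio Q_t(A_t | H_t) / P(A_t | H_t).  For a fixed
   sequence b of treatments, compare the trajectories that follow the observed
   equations before time k and are forced to play b from time k on.  Integrating
   out the uniforms V_t first (they are independent of everything else), the
   event that the flip intervention produces b contributes a product of flip
   probabilities, each depending only on the natural treatment and the history.
   Strong sequential randomization makes the natural treatment at time k
   conditionally independent, given H_k, of the whole continuation after k, so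
   its flip probability may be replaced by the conditional mean Q_k(b_k | H_k),
   and then by 1[A_k = b_k] Q_k / P_k because Q_k vanishes where P_k does.
   Moving k from 0 to T turns the interventional mean into the weighted observed
   mean; disintegrating the latter along the conditional laws of X_k given the
   past, from the last time backwards, yields the iterated integral.  Signed
   outcomes are treated through their positive and negative parts. *)
Require Import Defs.
From HB Require Import structures.
From mathcomp Require Import all_boot all_order all_algebra finmap.
From mathcomp Require Import all_classical all_reals all_analysis.
From mathcomp Require Import measurable_realfun ring lra.
Set Implicit Arguments.
Unset Strict Implicit.
Unset Printing Implicit Defensive.
Import Order.TTheory GRing.Theory Num.Theory.
Local Open Scope classical_set_scope.
Local Open Scope ring_scope.

(** * Positive functionals and a monotone class theorem *)

(** The assumptions on conditional laws, conditional independence and the uniforms speak of events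
    only, whereas the argument needs functions of a history together with all the noise after it.
    Each such passage compares two positive functionals that agree on events or rectangles. The
    noise itself is represented by the identity map into the sample space equipped with a smaller,
    generated sigma-algebra: a function measurable for that sigma-algebra, evaluated at [w], stands
    for a function of the corresponding exogenous variables. Versions of conditional probabilities
    are nonnegative only almost surely, while additivity and monotone convergence are applied to
    functions nonnegative everywhere; hence the recurrent absolute values. Integrability of the
    weighted outcome comes from that of the flipped outcome, through the identity for the absolute
    value. *)

Section PositiveFunctionals.
Import HBNNSimple.
Context (R : realType) (dT : measure_display) (S : measurableType dT).
Local Open Scope ereal_scope.

(** The properties of integration common to weighted means, kernel integrals and nested integrals,
    so that one uniqueness theorem serves them all without constructing joint measures. [I] is
    constrained on nonnegative measurable functions only; monotonicity follows from additivity. *)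
Record posfun (I : (S -> \bar R) -> \bar R) : Prop := PosFun {
  posfun_ge0 : forall f : S -> \bar R, measurable_fun setT f -> (forall x, 0 <= f x) ->
    0 <= I f ;
  posfunD : forall f g : S -> \bar R, measurable_fun setT f -> (forall x, 0 <= f x) ->
    measurable_fun setT g -> (forall x, 0 <= g x) ->
    I (fun x => f x + g x) = I f + I g ;
  posfunZ : forall (k : R) (f : S -> \bar R), (0 <= k)%R -> measurable_fun setT f ->
    (forall x, 0 <= f x) -> I (fun x => k%:E * f x) = k%:E * I f ;
  posfun_cvg : forall f_ : (S -> \bar R)^nat,
    (forall n, measurable_fun setT (f_ n)) -> (forall n x, 0 <= f_ n x) ->
    (forall x, nondecreasing_seq (f_^~ x)) ->
    I (f_ n) @[n --> \oo] --> I (fun x => limn (f_^~ x)) }.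

Lemma posfun0 I : posfun I -> I (fun=> 0) = 0.
Proof.
move=> HI; have := @posfunZ _ HI 0%R (fun=> 0) (lexx _) (measurable_cst _) (fun=> lexx _).
by under eq_fun do rewrite mule0; rewrite mul0e.
Qed.

Lemma posfun_sum I (J : Type) (s : seq J) (f : J -> S -> \bar R) : posfun I ->
  (forall j, measurable_fun setT (f j)) -> (forall j x, 0 <= f j x) ->
  I (fun x => \sum_(j <- s) f j x) = \sum_(j <- s) I (f j).
Proof.
move=> HI mf f0; elim: s => [|j s IH].
  by under eq_fun do rewrite big_nil; rewrite big_nil posfun0.
under eq_fun do rewrite big_cons.
rewrite posfunD ?IH ?big_cons //.
- exact: emeasurable_sum.
- by move=> x; apply: sume_ge0 => ? _.
Qed.

(* The factor [set x | measurable A] makes this [0] off the measurable sets,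
   where [I] is unconstrained. *)
Definition posfun_measure (I : (S -> \bar R) -> \bar R) (HI : posfun I)
  (A : set S) : \bar R := I (fun x => (\1_(A `&` [set x | measurable A]) x)%:E).

Lemma posfun_measureE I (HI : posfun I) A : measurable A ->
  posfun_measure HI A = I (fun x => (\1_A x)%:E).
Proof.
move=> mA; rewrite /posfun_measure; congr I; apply/funext => x.
by congr (\1_ _ _)%:E; apply/seteqP; split => y //= [].
Qed.

Section instance.
Variables (I : (S -> \bar R) -> \bar R) (HI : posfun I).

Let m0 : posfun_measure HI set0 = 0.
Proof.
rewrite posfun_measureE //.
by under eq_fun do rewrite indic0; rewrite posfun0.
Qed.

Let mge0 A : 0 <= posfun_measure HI A.
Proof.
have [mA|nA] := pselect (measurable A).
  rewrite posfun_measureE //; apply: posfun_ge0 => //.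
  exact/measurable_EFinP/measurable_indic.
rewrite /posfun_measure (_ : (fun _ => _) = fun=> 0) ?posfun0 //.
apply/funext => x; rewrite (_ : A `&` _ = set0) ?indic0 //.
by apply/seteqP; split => y //= [].
Qed.

Let madd : semi_sigma_additive (posfun_measure HI).
Proof.
move=> F mF tF mUF; rewrite posfun_measureE //.
have mi i : measurable_fun setT (fun x => (\1_(F i) x)%:E : \bar R).
  exact/measurable_EFinP/measurable_indic.
pose f_ n x : \bar R := \sum_(0 <= i < n) (\1_(F i) x)%:E.
have := @posfun_cvg _ HI f_.
rewrite (_ : (fun n => I (f_ n)) = fun n => \sum_(0 <= i < n) posfun_measure HI (F i)); last first.
  apply/funext => n; rewrite /f_ posfun_sum //; apply: eq_bigr => i _.
  by rewrite posfun_measureE.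
rewrite (_ : (fun x => limn (f_^~ x)) = (fun x => (\1_(\bigcup_n F n) x)%:E)); last first.
  apply/funext => x.
  apply/cvg_lim => //.
  (* Pointwise, the partial sums of indicators are those of the Dirac measure at [x], whose
     sigma-additivity gives the limit. *)
  exact: (@measure_semi_sigma_additive _ _ _ (@dirac _ S x R) F mF tF mUF).
apply.
- by move=> n; apply: emeasurable_sum.
- by move=> n x; apply: sume_ge0 => i _; rewrite lee_fin.
- by move=> x; apply: ereal_nondecreasing_series => i _ _; rewrite lee_fin.
Qed.

HB.instance Definition _ := isMeasure.Build _ _ _ (posfun_measure HI) m0 mge0 madd.
End instance.

(** Restricted to indicators, both functionals are measures, and finite measures agreeing on a
    generating pi-system coincide; simple approximation and monotone convergence then reach all
    nonnegative functions. *)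
Lemma posfun_eq I1 I2 (G : set (set S)) : posfun I1 -> posfun I2 ->
  measurable = <<s G >> -> setI_closed G -> G setT ->
  I1 (fun=> 1) < +oo ->
  (forall A, G A -> I1 (fun x => (\1_A x)%:E) = I2 (fun x => (\1_A x)%:E)) ->
  forall f : S -> \bar R, measurable_fun setT f -> (forall x, 0 <= f x) -> I1 f = I2 f.
Proof.
move=> H1 H2 mG GI GT fin1 GE.
have Gm A : G A -> measurable A by rewrite mG; apply: sub_sigma_algebra.
have AE A : measurable A -> I1 (fun x => (\1_A x)%:E) = I2 (fun x => (\1_A x)%:E).
  move=> mA; rewrite -(posfun_measureE H1 mA) -(posfun_measureE H2 mA).
  apply: (@measure_unique _ R _ G (fun=> setT) mG GI _ _ (posfun_measure H1) (posfun_measure H2)) => //.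
  - by rewrite bigcup_const.
  - move=> B GB; change (posfun_measure H1 B = posfun_measure H2 B).
    by rewrite !posfun_measureE ?GE //; exact: Gm.
  - move=> _; change (posfun_measure H1 setT < +oo); rewrite posfun_measureE //.
    by under eq_fun do rewrite indicT.
move=> f mf f0.
pose g := nnsfun_approx measurableT mf.
(* The absolute value makes every coefficient nonnegative, as [posfunZ] demands for each [y]; on the
   range of a nonnegative simple function it changes nothing. *)
have gE I : posfun I -> forall n, I (fun x => (g n x)%:E) =
    \sum_(y <- fset_set (range (g n))) `|y|%:E * I (fun x => (\1_(g n @^-1` [set y]) x)%:E).
  move=> HI n.
  transitivity (I (fun x => \sum_(y <- fset_set (range (g n))) `|y|%:E * (\1_(g n @^-1` [set y]) x)%:E)).
    congr I; apply/funext => x; rewrite [in LHS](fimfunE (g n) x) fsbig_finite//= sumEFin.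
    congr EFin; rewrite big_seq [RHS]big_seq; apply: eq_bigr => y ys.
    have /set_mem[z _ <-] : y \in range (g n) by rewrite -in_fset_set.
    congr (_ * _)%R.
    by rewrite ger0_norm.
  rewrite posfun_sum //.
  - apply: eq_bigr => y _; rewrite posfunZ //.
    exact/measurable_EFinP/measurable_indic.
  - move=> y; apply: measurable_funeM.
    exact/measurable_EFinP/measurable_indic.
have gl I : posfun I -> I f = limn (fun n => I (fun x => (g n x)%:E)).
  move=> HI; apply/esym/cvg_lim => //.
  have := @posfun_cvg _ HI (fun n x => (g n x)%:E).
  rewrite (_ : (fun x => limn (fun n => (g n x)%:E)) = f); last first.
    apply/funext => x; apply/cvg_lim => //.
    exact: cvg_nnsfun_approx.
  apply => //.
  - by move=> n; exact/measurable_EFinP.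
  - by move=> n x; rewrite lee_fin.
  - by move=> x m n mn; rewrite lee_fin; apply/lefP/nd_nnsfun_approx.
rewrite (gl _ H1) (gl _ H2); congr (limn _); apply/funext => n.
rewrite !gE //; apply: eq_bigr => y _; rewrite AE //.
Qed.

End PositiveFunctionals.

(** * Positive functionals built from integrals, weights and kernels *)

Section PositiveFunctionalConstructions.
Context (R : realType).
Local Open Scope ereal_scope.

Lemma posfun_point d (S : measurableType d) (x : S) :
  posfun (fun g : S -> \bar R => g x).
Proof.
split=> // f_ mf f0 nd.
exact/(@ereal_nondecreasing_is_cvgn _ (f_^~ x))/nd.
Qed.

(** Closure under integration of a measurable family yields the weighted and kernel functionals
    below. Monotone convergence under the integral sign requires each [J x] to be monotone, which is
    extracted from additivity. *)
Lemma posfun_integral d (S : measurableType d) d' (S' : measurableType d')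
    (mu : {measure set S -> \bar R}) (J : S -> (S' -> \bar R) -> \bar R) :
  (forall x, posfun (J x)) ->
  (forall g : S' -> \bar R, measurable_fun setT g -> (forall y, 0 <= g y) ->
    measurable_fun setT (J^~ g)) ->
  posfun (fun g => \int[mu]_x J x g).
Proof.
move=> HJ mJ; split.
- by move=> f mf f0; apply: integral_ge0 => x _; apply: posfun_ge0 (HJ x) _ _ _.
- move=> f g mf f0 mg g0.
  under eq_integral do rewrite (posfunD (HJ _))//.
  apply: ge0_integralD => //; by [apply: mJ|move=> x _; exact: (posfun_ge0 (HJ x))].
- move=> k f k0 mf f0.
  under eq_integral do rewrite (posfunZ (HJ _))//.
  by apply: ge0_integralZl_EFin => //;
    [move=> x _; exact: (posfun_ge0 (HJ x))|exact: mJ].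
- move=> f_ mf f0 nd.
  have ndJ x : nondecreasing_seq (fun n => J x (f_ n)).
    move=> n m nm.
    have ffin y : f_ n y != +oo -> f_ n y \is a fin_num.
      by move: (f0 n y); case: (f_ n y).
    (* The increment from [f_ n] to [f_ m]; where [f_ n] is already infinite so is [f_ m], and the
       increment is set to 0. *)
    have [h [mh h0 hE]] : exists h : S' -> \bar R, [/\ measurable_fun setT h,
        (forall y, 0 <= h y) & (forall y, f_ m y = f_ n y + h y)].
      exists (fun y => if f_ n y == +oo then 0 else f_ m y - f_ n y); split.
      + apply: measurable_fun_ifT => //; last exact: emeasurable_funB.
        have -> : (fun y => f_ n y == +oo) = (fun y => +oo <= f_ n y).
          by apply/funext => y; rewrite leye_eq.
        by apply: measurable_fun_lee => //; exact: measurable_cst.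
      + move=> y; case: ifPn => // fy; rewrite sube_ge0 ?ffin ?fy//.
        exact: nd.
      + move=> y; have := nd y _ _ nm; case: ifPn => [/eqP->|fy _].
          by rewrite leye_eq => /eqP->.
        by rewrite addeC subeK ?ffin.
    rewrite (_ : f_ m = fun y => f_ n y + h y); last exact/funext.
    by rewrite (posfunD (HJ x))// leeDl//; exact: (posfun_ge0 (HJ x)).
  rewrite (_ : (fun x => J x _) = (fun x => limn (fun n => J x (f_ n)))); last first.
    by apply/funext => x; apply/esym/cvg_lim => //; exact: (posfun_cvg (HJ x)).
  apply: cvg_monotone_convergence => [//|n|n x _|x _].
  + exact: mJ.
  + exact: (posfun_ge0 (HJ x)).
  + exact: ndJ.
Qed.

Lemma posfun_int d (S : measurableType d) (mu : {measure set S -> \bar R}) :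
  posfun (fun g => \int[mu]_x g x).
Proof. by apply: posfun_integral => // x; exact: posfun_point. Qed.

Lemma posfun_comp d (S : measurableType d) d' (S' : measurableType d')
    (I : (S -> \bar R) -> \bar R) (th : S -> S') :
  measurable_fun setT th -> posfun I -> posfun (fun g => I (g \o th)).
Proof.
move=> mth HI.
have mc (f : S' -> \bar R) : measurable_fun setT f -> measurable_fun setT (f \o th).
  by move=> mf; exact: measurableT_comp.
split.
- by move=> f mf f0; apply: posfun_ge0 => //; [exact: mc|move=> x; exact: f0].
- by move=> f g mf f0 mg g0; apply: (@posfunD _ _ _ _ HI (f \o th) (g \o th));
    [exact: mc|move=> x; exact: f0|exact: mc|move=> x; exact: g0].
- by move=> k f k0 mf f0; apply: (@posfunZ _ _ _ _ HI k (f \o th));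
    [|exact: mc|move=> x; exact: f0].
- move=> f_ mf f0 nd; apply: (@posfun_cvg _ _ _ _ HI (fun n => f_ n \o th)).
  + by move=> n; exact: mc.
  + by move=> n x; exact: f0.
  + by move=> x; exact: nd.
Qed.

Lemma posfun_scale d (S : measurableType d) (I : (S -> \bar R) -> \bar R)
    (c : R) : (0 <= c)%R -> posfun I -> posfun (fun g => c%:E * I g).
Proof.
move=> c0 HI; split.
- by move=> f mf f0; rewrite mule_ge0 ?lee_fin//; exact: posfun_ge0.
- by move=> f g mf f0 mg g0; rewrite posfunD// ge0_muleDr//; exact: posfun_ge0.
- by move=> k f k0 mf f0; rewrite posfunZ// muleCA.
- by move=> f_ mf f0 nd; apply: cvgeZl => //; exact: posfun_cvg.
Qed.

Lemma posfun_weight d (S : measurableType d) d' (S' : measurableType d')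
    (mu : {measure set S -> \bar R}) (c : S -> R) (th : S -> S') :
  measurable_fun setT c -> (forall x, 0 <= c x)%R -> measurable_fun setT th ->
  posfun (fun g => \int[mu]_x ((c x)%:E * g (th x))).
Proof.
move=> mc c0 mth; apply: posfun_integral => [x|g mg g0].
  by apply: posfun_scale => //; exact: posfun_point.
apply: emeasurable_funM; [exact/measurable_EFinP|exact: measurableT_comp].
Qed.

Lemma measurable_integral_kernel d (S : measurableType d)
    d' (S' : measurableType d') (k : R.-pker S ~> S') (g : S * S' -> \bar R) :
  measurable_fun setT g -> measurable_fun setT (fun x => \int[k x]_y g (x, y)).
Proof.
move=> mg.
rewrite (_ : (fun x => _) = (fun x => \int[k x]_y (g^\+ (x, y)) -
    \int[k x]_y (g^\- (x, y)))); last first.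
  apply/funext => x; rewrite [LHS]integralE.
  by congr (_ - _); apply: eq_integral => y _; rewrite ?(funeposE, funenegE).
apply: emeasurable_funB.
  apply: (@measurable_fun_integral_finite_kernel _ _ _ _ _ g^\+ k) => //.
  exact: measurable_funepos.
apply: (@measurable_fun_integral_finite_kernel _ _ _ _ _ g^\- k) => //.
exact: measurable_funeneg.
Qed.

(** The disintegrated side of a comparison: the second coordinate is drawn from the kernel at [C x]
    instead of being read off the sample. *)
Lemma posfun_kernel d (S : measurableType d) d1 (S1 : measurableType d1)
    d2 (S2 : measurableType d2)
    (mu : {measure set S -> \bar R}) (c : S -> R) (C : S -> S1)
    (k : R.-pker S1 ~> S2) :
  measurable_fun setT c -> (forall x, 0 <= c x)%R -> measurable_fun setT C ->
  posfun (fun g => \int[mu]_x ((c x)%:E * \int[k (C x)]_y g (C x, y))).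
Proof.
move=> mc c0 mC; apply: posfun_integral => [x|g mg g0].
  apply: posfun_scale => //.
  apply: (@posfun_comp _ _ _ _ (fun g => \int[k (C x)]_y g y) (pair (C x))).
    exact: pair1_measurable.
  exact: posfun_int.
apply: emeasurable_funM; first exact/measurable_EFinP.
apply: (@measurableT_comp _ _ _ _ _ _ (fun z => \int[k z]_y g (z, y))) => //.
exact: measurable_integral_kernel.
Qed.

Lemma posfun_eq_rect d1 (S1 : measurableType d1) d2 (S2 : measurableType d2)
    (I1 I2 : (S1 * S2 -> \bar R) -> \bar R) :
  posfun I1 -> posfun I2 -> I1 (fun=> 1) < +oo ->
  (forall A B, measurable A -> measurable B ->
    I1 (fun z => (\1_A z.1 * \1_B z.2)%:E) = I2 (fun z => (\1_A z.1 * \1_B z.2)%:E)) ->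
  forall f : S1 * S2 -> \bar R, measurable_fun setT f -> (forall x, 0 <= f x) ->
    I1 f = I2 f.
Proof.
move=> H1 H2 fin HE; apply: (posfun_eq H1 H2 (measurable_prod_measurableType _ _)) => //.
- move=> _ _ [A mA [B mB <-]] [A' mA' [B' mB' <-]].
  by exists (A `&` A'); [exact: measurableI|exists (B `&` B');
    [exact: measurableI|rewrite setXI]].
- by exists setT => //; exists setT => //; rewrite setXTT.
- move=> _ [A mA [B mB <-]].
  have -> : (fun z => (\1_(A `*` B) z)%:E : \bar R) = (fun z => (\1_A z.1 * \1_B z.2)%:E).
    by apply/funext => -[x y]; rewrite !indicE in_setX -natrM mulnb.
  exact: HE.
Qed.

End PositiveFunctionalConstructions.

(** * Conditional expectations *)

Section ConditionalExpectations.
Context (R : realType) (dO : measure_display) (Omega : measurableType dO).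
Context (P : probability Omega R).
Local Open Scope ereal_scope.

Lemma integral_ae_congr (f g : Omega -> \bar R) :
  measurable_fun setT f -> measurable_fun setT g ->
  (\forall w \ae P, f w = g w) -> \int[P]_w f w = \int[P]_w g w.
Proof.
move=> mf mg fg; apply: ae_eq_integral => //.
by apply: filterS fg => w + _.
Qed.

Lemma integral_set_indic (D : set Omega) (f : Omega -> \bar R) :
  \int[P]_(w in D) f w = \int[P]_w (f w * (\1_D w)%:E).
Proof.
rewrite integral_mkcond; apply: eq_integral => w _.
by rewrite patchE indicE; case: ifP; rewrite ?mule1 ?mule0.
Qed.

Lemma integral_ge0_weight (c : Omega -> R) (g : Omega -> \bar R) :
  (forall w, 0 <= c w)%R ->
  \int[P]_w ((c w)%:E * g w) =
  \int[P]_w ((c w)%:E * g^\+ w) - \int[P]_w ((c w)%:E * g^\- w).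
Proof.
move=> c0; rewrite [LHS]integralE; congr (_ - _); apply: eq_integral => w _.
  have := congr1 (fun f => f tt) (ge0_funeposM (fun _ : unit => g w) (c0 w)).
  by rewrite !funeposE.
have := congr1 (fun f => f tt) (ge0_funenegM (fun _ : unit => g w) (c0 w)).
by rewrite !funenegE.
Qed.

(** Nonnegative weights commute with positive and negative parts, so the two sides are the same
    difference term by term, even when it is infinite. *)
Lemma weighted_eq_signed d' (S' : measurableType d') (c1 c2 : Omega -> R)
    (th : Omega -> S') :
  (forall w, 0 <= c1 w)%R -> (forall w, 0 <= c2 w)%R ->
  (forall g : S' -> \bar R, measurable_fun setT g -> (forall x, 0 <= g x) ->
    \int[P]_w ((c1 w)%:E * g (th w)) = \int[P]_w ((c2 w)%:E * g (th w))) ->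
  forall g : S' -> \bar R, measurable_fun setT g ->
    \int[P]_w ((c1 w)%:E * g (th w)) = \int[P]_w ((c2 w)%:E * g (th w)).
Proof.
move=> c10 c20 H g mg.
rewrite (integral_ge0_weight (fun w => g (th w)) c10).
rewrite (integral_ge0_weight (fun w => g (th w)) c20).
have -> : (fun w => g (th w))^\+ = g^\+ \o th.
  by apply/funext => w; rewrite /= !funeposE.
have -> : (fun w => g (th w))^\- = g^\- \o th.
  by apply/funext => w; rewrite /= !funenegE.
congr (_ - _).
  by apply: (H (g^\+)) => //; exact: measurable_funepos.
by apply: (H (g^\-)) => //; exact: measurable_funeneg.
Qed.

(** With [c1] and [c2] read as densities, the images under [th] of the two weighted measures agree
    on sets, hence on functions. *)
Lemma weighted_eq d' (S' : measurableType d') (c1 c2 : Omega -> R)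
    (th : Omega -> S') :
  measurable_fun setT c1 -> measurable_fun setT c2 ->
  (forall w, 0 <= c1 w)%R -> (forall w, 0 <= c2 w)%R ->
  measurable_fun setT th ->
  \int[P]_w (c1 w)%:E < +oo ->
  (forall B, measurable B -> \int[P]_(w in th @^-1` B) (c1 w)%:E =
    \int[P]_(w in th @^-1` B) (c2 w)%:E) ->
  forall g : S' -> \bar R, measurable_fun setT g -> (forall x, 0 <= g x) ->
    \int[P]_w ((c1 w)%:E * g (th w)) = \int[P]_w ((c2 w)%:E * g (th w)).
Proof.
move=> mc1 mc2 c10 c20 mth fin1 H.
apply: (posfun_eq (posfun_weight P mc1 c10 mth) (posfun_weight P mc2 c20 mth)
  (G := measurable)).
- by rewrite sigma_algebra_id//; exact: sigma_algebra_measurable.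
- exact: measurableI.
- exact: measurableT.
- by under eq_integral do rewrite mule1.
- move=> A mA; have e (c : Omega -> R) : \int[P]_w ((c w)%:E * (\1_A (th w))%:E) =
      \int[P]_(w in th @^-1` A) (c w)%:E.
    rewrite [RHS]integral_set_indic; apply: eq_integral => w _.
    by rewrite !indicE; congr (_ * (_%:R)%:E); apply/idP/idP; rewrite !inE.
  by rewrite !e H.
Qed.

Lemma weighted_eq_rect d1 (S1 : measurableType d1) d2 (S2 : measurableType d2)
    (c1 c2 : Omega -> R) (th1 : Omega -> S1) (th2 : Omega -> S2) :
  measurable_fun setT c1 -> measurable_fun setT c2 ->
  (forall w, 0 <= c1 w)%R -> (forall w, 0 <= c2 w)%R ->
  measurable_fun setT th1 -> measurable_fun setT th2 ->
  \int[P]_w (c1 w)%:E < +oo ->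
  (forall A B, measurable A -> measurable B ->
    \int[P]_w ((c1 w)%:E * (\1_A (th1 w) * \1_B (th2 w))%:E) =
    \int[P]_w ((c2 w)%:E * (\1_A (th1 w) * \1_B (th2 w))%:E)) ->
  forall g : S1 * S2 -> \bar R, measurable_fun setT g -> (forall x, 0 <= g x) ->
    \int[P]_w ((c1 w)%:E * g (th1 w, th2 w)) =
    \int[P]_w ((c2 w)%:E * g (th1 w, th2 w)).
Proof.
move=> mc1 mc2 c10 c20 mth1 mth2 fin1 H.
have mth : measurable_fun setT (fun w => (th1 w, th2 w)) by exact: measurable_fun_pair.
apply: (posfun_eq_rect (posfun_weight P mc1 c10 mth) (posfun_weight P mc2 c20 mth)).
- by under eq_integral do rewrite mule1.
- by move=> A B mA mB; exact: H.
Qed.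

Section Version.
Context (dC : measure_display) (TC : measurableType dC).
Variables (C : Omega -> TC).
Hypothesis mC : measurable_fun setT C.

(** Tested on the set where [phi] is negative, the defining identity equates a nonnegative integral
    with minus the integral of the absolute value of [phi]; both vanish. *)
Lemma isCondExp_ae_ge0 (Z : Omega -> R) (phi : TC -> R) :
  (forall w, 0 <= Z w)%R -> isCondExp P Z C phi ->
  \forall w \ae P, (0 <= phi (C w))%R.
Proof.
move=> Z0 [mphi H].
pose B := [set x | (phi x < 0)%R].
have mB : measurable B.
  rewrite (_ : B = setT `&` phi @^-1` `]-oo, 0%R[%classic); first exact: mphi.
  by rewrite setTI; apply/seteqP; split => x; rewrite /B /= in_itv/=.
have mCB : measurable (C @^-1` B) by rewrite -[X in measurable X]setTI; exact: mC.
have mpc : measurable_fun (C @^-1` B) (fun w => (phi (C w))%:E).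
  apply: measurable_funTS; apply/measurable_EFinP; exact: measurableT_comp.
have I0 : \int[P]_(w in C @^-1` B) `|(phi (C w))%:E| = 0.
  apply/eqP; rewrite eq_le integral_ge0// andbT -oppe_ge0.
  rewrite -integral_ge0N//.
  have <- : \int[P]_(w in C @^-1` B) (Z w)%:E =
      \int[P]_(w in C @^-1` B) (- `|(phi (C w))%:E|).
    rewrite H //; apply: eq_integral => w /set_mem lt0.
    by rewrite abse_EFin ltr0_norm// EFinN oppeK.
  by apply: integral_ge0 => w _; rewrite lee_fin.
have [+ _] := @ae_eq_integral_abs _ _ _ P _ mCB _ mpc.
move=> /(_ I0); apply: filterS => w Hw; rewrite leNgt; apply/negP => lt0.
by have := Hw lt0 => -[e]; move: lt0; rewrite e ltxx.
Qed.

(** Almost surely [phi] equals its absolute value, so the identity compares two nonnegative weights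
    and therefore holds for every measurable test function, signed or of infinite integral. *)
Lemma isCondExp_indic (E : set Omega) (phi : TC -> R) : measurable E ->
  isCondExp P (\1_E) C phi -> forall g : TC -> \bar R, measurable_fun setT g ->
  \int[P]_w ((\1_E w)%:E * g (C w)) = \int[P]_w ((phi (C w))%:E * g (C w)).
Proof.
move=> mE ce g mg; have [mphi H] := ce.
have ae0 : \forall w \ae P, (0 <= phi (C w))%R by exact: isCondExp_ae_ge0 ce.
have mphiC : measurable_fun setT (phi \o C) by exact: measurableT_comp.
have mgC : measurable_fun setT (g \o C) by exact: measurableT_comp.
have mn : measurable_fun setT (fun w => `|phi (C w)|%R).
  exact: (measurableT_comp (@normr_measurable R setT)).
rewrite [RHS](@integral_ae_congr _ (fun w => `|phi (C w)|%:E * g (C w))); last 3 first.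
- by apply: emeasurable_funM => //; exact/measurable_EFinP.
- by apply: emeasurable_funM => //; exact/measurable_EFinP.
- by apply: filterS ae0 => w w0; rewrite ger0_norm.
apply: weighted_eq_signed => //; apply: weighted_eq => //.
- by rewrite integral_indic// setIT (le_lt_trans (probability_le1 _ _))// ltry.
- move=> B mB; rewrite H// !(integral_set_indic (C @^-1` B)); apply: integral_ae_congr.
  + apply: emeasurable_funM; apply/measurable_EFinP => //.
    by apply: measurable_indic; rewrite -[X in measurable X]setTI; exact: mC.
  + apply: emeasurable_funM; apply/measurable_EFinP => //.
    by apply: measurable_indic; rewrite -[X in measurable X]setTI; exact: mC.
  + by apply: filterS ae0 => w w0; rewrite ger0_norm.
Qed.

Lemma isCondExp_indic_integrable (E : set Omega) (phi : TC -> R) :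
  measurable E -> isCondExp P (\1_E) C phi ->
  P.-integrable setT (fun w => (phi (C w))%:E).
Proof.
move=> mE ce; have [mphi H] := ce.
have mp : measurable_fun setT (fun w => (phi (C w))%:E).
  by apply/measurable_EFinP; exact: measurableT_comp.
apply/integrableP; split => //.
rewrite (@integral_ae_congr _ (fun w => (phi (C w))%:E)) //; last 2 first.
- exact: measurableT_comp.
- have : \forall w \ae P, (0 <= phi (C w))%R by exact: isCondExp_ae_ge0 ce.
  by apply: filterS => w w0; rewrite /= ger0_norm.
have := isCondExp_indic mE ce (measurable_cst 1).
under eq_integral do rewrite mule1.
under [X in _ = X -> _]eq_integral do rewrite mule1.
move=> <-; rewrite integral_indic// setIT.
by rewrite (le_lt_trans (probability_le1 _ _))// ltry.
Qed.

Lemma isCondExp_compl (E : set Omega) (phi : TC -> R) : measurable E ->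
  isCondExp P (\1_E) C phi -> isCondExp P (\1_(~` E)) C (fun x => 1 - phi x)%R.
Proof.
move=> mE ce; have [mphi H] := ce; split; first exact: measurable_funB.
move=> B mB.
have mCB : measurable (C @^-1` B) by rewrite -[X in measurable X]setTI; exact: mC.
have fin : P.-integrable (C @^-1` B) (fun w => (\1_E w)%:E).
  by apply: (integrableS measurableT) => //; exact: integrable_indic.
have int1 : P.-integrable (C @^-1` B) (fun w => 1%:E).
  apply: finite_measure_integrable_cst => //.
have intphi : P.-integrable (C @^-1` B) (fun w => (phi (C w))%:E).
  exact: (integrableS measurableT mCB (@subsetT _ _) (isCondExp_indic_integrable mE ce)).
transitivity (\int[P]_(w in C @^-1` B) (1%:E - (\1_E w)%:E)).
  by apply: eq_integral => w _; rewrite !indicE in_setC; case: (w \in E);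
    rewrite /= ?subee ?sube0.
rewrite integralB// H// -integralB//.
Qed.
End Version.
End ConditionalExpectations.

(** * Conditional independence *)

Section ConditionalLaws.
Context (R : realType) (dO : measure_display) (Omega : measurableType dO).
Context (P : probability Omega R).
Local Open Scope ereal_scope.

Lemma measurable_preim d (S : measurableType d) (f : Omega -> S) (B : set S) :
  measurable_fun setT f -> measurable B -> measurable (f @^-1` B).
Proof. by move=> mf mB; rewrite -[X in measurable X]setTI; exact: mf. Qed.

Lemma indic_preim d (S : measurableType d) (f : Omega -> S) (B : set S) w :
  \1_(f @^-1` B) w = \1_B (f w) :> R.
Proof. by rewrite !indicE; congr (_%:R); apply/idP/idP; rewrite !inE. Qed.

Lemma measurable_id_gsigma (G : set (set Omega)) : G `<=` measurable ->
  measurable_fun setT (id : Omega -> g_sigma_algebraType G).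
Proof.
move=> Gm _ A mA; rewrite setTI.
exact: (smallest_sub (@sigma_algebra_measurable _ Omega) Gm) mA.
Qed.

(** Conditional independence concerns events of [Z] alone, but a treatment is an event of [C] and
    [Z] jointly. For [E] in the sigma-algebra of [G] and [psi] a version of P(E | C), the weights
    1_E and psi(C) agree on rectangles in (C, Z), hence on [D]. The test function is then extended
    from products 1_B(C) 1_E to all [g]. *)
Lemma condIndep_weight d1 (T1 : measurableType d1) dC (TC : measurableType dC)
    (Z : Omega -> T1) (C : Omega -> TC) (G : set (set Omega))
    (D : set (TC * T1)) (phi : TC -> R) :
  measurable_fun setT Z -> measurable_fun setT C -> G `<=` measurable ->
  measurable D -> condIndep P Z G C ->
  isCondExp P (\1_[set w | D (C w, Z w)]) C phi ->
  forall g : TC * g_sigma_algebraType G -> \bar R, measurable_fun setT g ->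
  \int[P]_w ((\1_[set w | D (C w, Z w)] w)%:E * g (C w, w)) =
  \int[P]_w ((phi (C w))%:E * g (C w, w)).
Proof.
move=> mZ mC Gm mD ci cephi.
have mCZ : measurable_fun setT (fun w => (C w, Z w)) by exact: measurable_fun_pair.
have mid := measurable_id_gsigma Gm.
set DD := [set w | D (C w, Z w)].
have mDD : measurable DD by exact: (measurable_preim mCZ mD).
have [mphi _] := cephi.
have mi d (S : measurableType d) (f : Omega -> S) B : measurable_fun setT f ->
    measurable B -> measurable_fun setT (fun w => \1_B (f w) : R).
  by move=> mf mB; apply: (@measurableT_comp _ _ _ _ _ _ (\1_B : S -> R) _ f).
have mn (f : TC -> R) : measurable_fun setT f ->
    measurable_fun setT (fun w => `|f (C w)|%R).
  move=> mf; apply: (measurableT_comp (@normr_measurable R setT)).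
  exact: measurableT_comp.
have mf' (f : TC -> R) : measurable_fun setT f -> measurable_fun setT (fun w => f (C w)).
  by move=> mf; exact: measurableT_comp.
have phi0 : \forall w \ae P, (0 <= phi (C w))%R by exact: isCondExp_ae_ge0 cephi.
have key E : <<s G >> E -> forall B, measurable B ->
    \int[P]_w ((\1_DD w)%:E * (\1_B (C w) * \1_E w)%:E) =
    \int[P]_w ((phi (C w))%:E * (\1_B (C w) * \1_E w)%:E).
  move=> GE.
  have mE : measurable E by rewrite -[E]setTI; exact: mid.
  (* The trivial event serves only to fix one version [psi] of P(E | C); [condIndep] supplies
     versions that may change with [S]. *)
  have [_ [psi [_ cepsi _]]] := ci setT measurableT E GE.
  have [mpsi _] := cepsi.
  have psi0 : \forall w \ae P, (0 <= psi (C w))%R by exact: isCondExp_ae_ge0 cepsi.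
  have rect B S : measurable B -> measurable S ->
      \int[P]_w ((\1_E w)%:E * (\1_B (C w) * \1_S (Z w))%:E) =
      \int[P]_w (`|psi (C w)|%:E * (\1_B (C w) * \1_S (Z w))%:E).
    move=> mB mS.
    have [phi1 [phi2 [ce1 ce2 [_ ce12]]]] := ci S mS E GE.
    have [mphi1 _] := ce1; have [mphi2 _] := ce2.
    have mZS : measurable (Z @^-1` S) by exact: measurable_preim.
    transitivity (\int[P]_(w in C @^-1` B) (\1_(Z @^-1` S `&` E) w)%:E).
      rewrite [RHS]integral_set_indic; apply: eq_integral => w _.
      by rewrite indicI /= !indic_preim -!EFinM; congr EFin; ring.
    rewrite ce12// [LHS]integral_set_indic.
    transitivity (\int[P]_w ((phi2 (C w))%:E * (phi1 (C w) * \1_B (C w))%:E)).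
      apply: eq_integral => w _.
      by rewrite indic_preim -!EFinM; congr EFin; rewrite /=; ring.
    have mg1 : measurable_fun setT (fun x => (phi1 x * \1_B x)%:E).
      by apply/measurable_EFinP; apply: measurable_funM => //; exact: measurable_indic.
    have mg2 : measurable_fun setT (fun x => (psi x * \1_B x)%:E).
      by apply/measurable_EFinP; apply: measurable_funM => //; exact: measurable_indic.
    (* The version [phi2] attached to [S] is exchanged for [psi] by passing through 1_E; afterwards
       [phi1] is traded for the indicator of Z in [S]. *)
    rewrite -(isCondExp_indic mC mE ce2 mg1) (isCondExp_indic mC mE cepsi mg1).
    transitivity (\int[P]_w ((phi1 (C w))%:E * (psi (C w) * \1_B (C w))%:E)).
      by apply: eq_integral => w _; rewrite -!EFinM; congr EFin; ring.
    rewrite -(isCondExp_indic mC mZS ce1 mg2).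
    apply: integral_ae_congr.
    - apply/measurable_EFinP; apply: measurable_funM => //.
      by apply: measurable_funM; [exact: mf'|exact: mi].
    - apply/measurable_EFinP; apply: measurable_funM; first exact: mn.
      by apply: measurable_funM; exact: mi.
    - apply: filterS psi0 => w w0; rewrite ger0_norm// indic_preim -!EFinM.
      by congr EFin; ring.
  move=> B mB.
  have e1 w : \1_DD w = \1_D (C w, Z w) :> R by exact: (indic_preim (fun w => (C w, Z w))).
  have e2 w : \1_(B `*` setT) (C w, Z w) = \1_B (C w) :> R.
    by rewrite !indicE in_setX /= in_setT andbT.
  transitivity (\int[P]_w ((\1_E w)%:E * (\1_(D `&` (B `*` setT)) (C w, Z w))%:E)).
    apply: eq_integral => w _; rewrite indicI /= -!EFinM; congr EFin.
    by rewrite e1 e2; ring.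
  have mDB : measurable (D `&` (B `*` setT)) by apply: measurableI => //; exact: measurableX.
  have -> := weighted_eq_rect _ _ _ _ mC mZ _ rect
    (g := fun z => (\1_(D `&` (B `*` setT)) z)%:E).
  - transitivity (\int[P]_w ((\1_DD w)%:E * (psi (C w) * \1_B (C w))%:E)).
      apply: integral_ae_congr.
      + apply/measurable_EFinP; apply: measurable_funM; first exact: mn.
        exact: (mi _ _ (fun w => (C w, Z w))).
      + apply/measurable_EFinP; apply: measurable_funM; first exact: measurable_indic.
        by apply: measurable_funM; [exact: mf'|exact: mi].
      + apply: filterS psi0 => w w0; rewrite ger0_norm// indicI /= -!EFinM.
        congr EFin.
        by rewrite e1 e2; ring.
    rewrite (isCondExp_indic mC mDD cephi (g := fun x => (psi x * \1_B x)%:E)); last first.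
      by apply/measurable_EFinP; apply: measurable_funM => //; exact: measurable_indic.
    transitivity (\int[P]_w ((psi (C w))%:E * (phi (C w) * \1_B (C w))%:E)).
      by apply: eq_integral => w _; rewrite -!EFinM; congr EFin; ring.
    rewrite -(isCondExp_indic mC mE cepsi (g := fun x => (phi x * \1_B x)%:E)); last first.
      by apply/measurable_EFinP; apply: measurable_funM => //; exact: measurable_indic.
    by apply: eq_integral => w _; rewrite -!EFinM; congr EFin; ring.
  - exact: measurable_indic.
  - exact: mn.
  - by [].
  - by [].
  - by rewrite integral_indic// setIT (le_lt_trans (probability_le1 _ _))// ltry.
  - exact/measurable_EFinP/measurable_indic.
  - by move=> x; rewrite lee_fin.
move=> g mg.
have mCw : measurable_fun setT (fun w => (C w, w : g_sigma_algebraType G)).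
  exact: measurable_fun_pair.
have mgC : measurable_fun setT (fun w => g (C w, w)) by exact: (measurableT_comp mg mCw).
transitivity (\int[P]_w (`|phi (C w)|%:E * g (C w, w))); last first.
  apply: integral_ae_congr.
  - by apply: emeasurable_funM => //; apply/measurable_EFinP; exact: mn.
  - by apply: emeasurable_funM => //; apply/measurable_EFinP; exact: mf'.
  - by apply: filterS phi0 => w w0; rewrite ger0_norm.
apply: (weighted_eq_signed (P := P) (th := fun w => (C w, w : g_sigma_algebraType G)) _ _ _ mg) => //.
apply: (weighted_eq_rect (P := P) _ _ _ _ mC mid) => //.
- exact: mn.
- by rewrite integral_indic// setIT (le_lt_trans (probability_le1 _ _))// ltry.
- move=> B E mB GE; rewrite key//; apply: integral_ae_congr.
  + apply/measurable_EFinP; apply: measurable_funM; first exact: mf'.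
    by apply: measurable_funM; [exact: mi|exact: (mi _ _ _ _ mid)].
  + apply/measurable_EFinP; apply: measurable_funM; first exact: mn.
    by apply: measurable_funM; [exact: mi|exact: (mi _ _ _ _ mid)].
  + by apply: filterS phi0 => w w0; rewrite ger0_norm.
Qed.
End ConditionalLaws.

(** * Disintegration, conditional means and independent uniforms *)

Section DisintegrationAndRandomization.
Context (R : realType) (dO : measure_display) (Omega : measurableType dO).
Context (P : probability Omega R).
Local Open Scope ereal_scope.

Section Kernel.
Context dC (TC : measurableType dC) d2 (S2 : measurableType d2).
Variables (C : Omega -> TC) (X : Omega -> S2) (k : R.-pker TC ~> S2).
Hypotheses (mC : measurable_fun setT C) (mX : measurable_fun setT X).
Hypothesis law : forall B, measurable B ->
  isCondExp P (\1_[set w | X w \in B]) C (fun h => fine (k h B)).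

Lemma pker_fin_num x B : measurable B -> k x B \is a fin_num.
Proof.
move=> mB; rewrite ge0_fin_numE//; apply: (@le_lt_trans _ _ (k x setT)).
  by apply: le_measure; rewrite ?inE.
by rewrite prob_kernel ltry.
Qed.

(** On a rectangle this is the definition of a conditional law: the version attached to the second
    side is tested against the indicator of the first. *)
Lemma kernel_disintegration (g : TC * S2 -> \bar R) :
  measurable_fun setT g -> (forall z, 0 <= g z) ->
  \int[P]_w g (C w, X w) = \int[P]_w \int[k (C w)]_x g (C w, x).
Proof.
move=> mg g0.
have m1 : measurable_fun setT (fun _ : Omega => 1%R : R) by exact: measurable_cst.
have p1 (w : Omega) : (0 <= 1 :> R)%R by [].
transitivity (\int[P]_w (1%:E * g (C w, X w))).
  by apply: eq_integral => w _; rewrite mul1e.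
transitivity (\int[P]_w (1%:E * \int[k (C w)]_x g (C w, x))); last first.
  by apply: eq_integral => w _; rewrite mul1e.
apply: (posfun_eq_rect (posfun_weight P m1 p1 (measurable_fun_pair mC mX))
  (posfun_kernel P k m1 p1 mC)) mg g0.
  under eq_integral do rewrite mul1e.
  by rewrite integral_cst// mul1e (le_lt_trans (probability_le1 _ _))// ltry.
move=> A B mA mB.
have XB : [set w | X w \in B] = X @^-1` B.
  by apply/seteqP; split => w; [exact: set_mem|exact: mem_set].
have := law mB; rewrite XB => ce.
transitivity (\int[P]_w ((\1_(X @^-1` B) w)%:E * (\1_A (C w))%:E)).
  by apply: eq_integral => w _; rewrite mul1e/= indic_preim -EFinM mulrC.
rewrite (isCondExp_indic mC (measurable_preim mX mB) ce (g := fun x => (\1_A x)%:E)); last first.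
  exact/measurable_EFinP/measurable_indic.
apply: eq_integral => w _; rewrite mul1e/=.
under [RHS]eq_integral do rewrite EFinM.
rewrite ge0_integralZl//; last exact/measurable_EFinP/measurable_indic.
by rewrite integral_indic// setIT [RHS]muleC fineK// pker_fin_num.
Qed.

(** The nonnegative case applied to the absolute value of [g] bounds the inner integrals of both
    parts, so their difference can be integrated termwise. *)
Lemma kernel_disintegration_integrable (g : TC * S2 -> \bar R) :
  measurable_fun setT g -> P.-integrable setT (fun w => g (C w, X w)) ->
  P.-integrable setT (fun w => \int[k (C w)]_x g (C w, x)) /\
  \int[P]_w \int[k (C w)]_x g (C w, x) = \int[P]_w g (C w, X w).
Proof.
move=> mg ig; have /integrableP[mgCX gfin] := ig.
have mgp := measurable_funepos mg; have mgn := measurable_funeneg mg.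
have mJ (f : TC * S2 -> \bar R) : measurable_fun setT f ->
    measurable_fun setT (fun w => \int[k (C w)]_x f (C w, x)).
  move=> mf; apply: (@measurableT_comp _ _ _ _ _ _ (fun z => \int[k z]_y f (z, y)) _ C _ mC).
  exact: measurable_integral_kernel.
have mga : measurable_fun setT (fun z => `|g z|) by exact: measurableT_comp.
have afin : \int[P]_w \int[k (C w)]_x `|g (C w, x)| < +oo.
  by rewrite -(kernel_disintegration (g := fun z => `|g z|)).
have iJ (f : TC * S2 -> \bar R) : measurable_fun setT f ->
    (forall z, 0 <= f z) -> (forall z, f z <= `|g z|) ->
    P.-integrable setT (fun w => \int[k (C w)]_x f (C w, x)).
  move=> mf f0 fg; apply/integrableP; split; first exact: mJ.
  apply: le_lt_trans afin; apply: ge0_le_integral => //.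
  - by apply: measurableT_comp => //; exact: mJ.
  - exact: (mJ (fun z => `|g z|)).
  - move=> w _; rewrite gee0_abs ?integral_ge0//; apply: ge0_le_integral => //.
    + exact: (measurableT_comp mf (pair1_measurable (C w))).
    + exact: (measurableT_comp mga (pair1_measurable (C w))).
have ip := iJ _ mgp (fun z => funepos_ge0 g z) _.
have im := iJ _ mgn (fun z => funeneg_ge0 g z) _.
have {}ip : P.-integrable setT (fun w => \int[k (C w)]_x g^\+ (C w, x)).
  by apply: ip => z; rewrite -[leRHS]/((abse \o g) z) fune_abse /= leeDl.
have {}im : P.-integrable setT (fun w => \int[k (C w)]_x g^\- (C w, x)).
  by apply: im => z; rewrite -[leRHS]/((abse \o g) z) fune_abse /= leeDr.
have JE w : \int[k (C w)]_x g (C w, x) =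
    \int[k (C w)]_x g^\+ (C w, x) - \int[k (C w)]_x g^\- (C w, x).
  rewrite [LHS]integralE.
  by congr (_ - _); apply: eq_integral => y _; rewrite ?(funeposE, funenegE).
split.
- rewrite (_ : (fun w => _) = (fun w => \int[k (C w)]_x g^\+ (C w, x) - \int[k (C w)]_x g^\- (C w, x))); last exact/funext.
  exact: integrableB.
- under eq_integral do rewrite JE.
  rewrite integralB// -!kernel_disintegration//.
  rewrite [RHS]integralE.
  by congr (_ - _); apply: eq_integral => w _; rewrite ?(funeposE, funenegE).
Qed.
End Kernel.

(* [g] is unbounded: the integrability of [m g] comes from testing the identity
   E(Y^+ + m^-; g') = E(Y^- + m^+; g') on [g' = g] restricted to [m >= 0], resp. [m < 0]. *)
Lemma isCondExp_weight dC (TC : measurableType dC) (C : Omega -> TC)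
    (Y : Omega -> R) (m g : TC -> R) :
  measurable_fun setT C -> isCondExp P Y C m ->
  P.-integrable setT (EFin \o Y) ->
  measurable_fun setT g -> (forall x, 0 <= g x)%R ->
  P.-integrable setT (fun w => (Y w * g (C w))%:E) ->
  P.-integrable setT (fun w => (m (C w) * g (C w))%:E) /\
  \int[P]_w (m (C w) * g (C w))%:E = \int[P]_w (Y w * g (C w))%:E.
Proof.
move=> mC [mm H] iY mg g0 iYg.
pose p (x : R) := Num.max x 0%R.
have p0 x : (0 <= p x)%R by rewrite /p le_max lexx orbT.
have pB x : (p x - p (- x) = x)%R.
  by rewrite /p; case: (leP x 0%R) => h; case: (leP (- x)%R 0%R); lra.
have ple x : (p x <= `|x|)%R by rewrite /p ge_max ler_norm normr_ge0.
have mp (f : Omega -> R) : measurable_fun setT f -> measurable_fun setT (fun w => p (f w)).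
  by move=> mf; exact: measurable_maxr.
have mY : measurable_fun setT Y by exact/measurable_EFinP/(measurable_int P).
have mgC : measurable_fun setT (fun w => g (C w)) by exact: measurableT_comp.
have mmC : measurable_fun setT (fun w => m (C w)) by exact: measurableT_comp.
have mNY : measurable_fun setT (fun w => - Y w)%R by exact: measurableT_comp.
have mNmC : measurable_fun setT (fun w => - m (C w))%R by exact: measurableT_comp.
have dom (f h : Omega -> R) : measurable_fun setT f ->
    (forall w, `|f w| <= `|h w|)%R -> P.-integrable setT (fun w => (h w)%:E) ->
    P.-integrable setT (fun w => (f w)%:E).
  move=> mf fh; apply: le_integrable => //; first exact/measurable_EFinP.
  by move=> w _; rewrite !abse_EFin lee_fin.
pose M := [set x | (0 <= m x)%R].
have mM : measurable M.
  rewrite (_ : M = setT `&` m @^-1` `[0%R, +oo[%classic); first exact: mm.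
  by rewrite setTI; apply/seteqP; split => x; rewrite /M /= in_itv/= andbT.
have iYD D : measurable D -> P.-integrable D (EFin \o Y).
  by move=> mD; apply: (integrableS measurableT).
(* On the whole space the integral of m(C) is that of [Y], hence finite; a difference of two
   nonnegative integrals is finite only if both are. *)
have imD : P.-integrable setT (fun w => (m (C w))%:E).
  apply/integrableP; split; first exact/measurable_EFinP.
  have mf : measurable_fun setT (fun w => (m (C w))%:E) by exact/measurable_EFinP.
  have : \int[P]_w (m (C w))%:E \is a fin_num.
    have := H setT measurableT; rewrite preimage_setT => <-.
    exact: (integrable_fin_num measurableT iY).
  rewrite integralE fin_numB => /andP[fp fn].
  rewrite (_ : \int[P]_w _ = \int[P]_w ((fun w => (m (C w))%:E)^\+ w +
      (fun w => (m (C w))%:E)^\- w)); last first.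
    apply: eq_integral => w _.
    by rewrite -[LHS]/((abse \o (fun w => (m (C w))%:E)) w) fune_abse.
  rewrite ge0_integralD//; [|exact: measurable_funepos|exact: measurable_funeneg].
  by rewrite lte_add_pinfty// ltey_eq ?fp ?fn.
(* Moving negative parts across turns the defining identity of [m] into an equality of nonnegative
   weights, with c1 - c2 = Y - m(C). *)
pose c1 w := (p (Y w) + p (- m (C w)))%R.
pose c2 w := (p (- Y w) + p (m (C w)))%R.
have i1 : P.-integrable setT (fun w => (c1 w)%:E).
  rewrite (_ : (fun w => _) = (fun w => (p (Y w))%:E + (p (- m (C w)))%:E)); last first.
    by apply/funext => w; rewrite -EFinD.
  apply: integrableD => //.
    by apply: (dom _ Y) => //; [exact: mp|move=> w; rewrite ger0_norm].
  by apply: (dom _ (m \o C)) => //; [exact: mp|move=> w; rewrite ger0_norm// -normrN].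
have i2 : P.-integrable setT (fun w => (c2 w)%:E).
  rewrite (_ : (fun w => _) = (fun w => (p (- Y w))%:E + (p (m (C w)))%:E)); last first.
    by apply/funext => w; rewrite -EFinD.
  apply: integrableD => //.
    by apply: (dom _ Y) => //; [exact: mp|move=> w; rewrite ger0_norm// -normrN].
  by apply: (dom _ (m \o C)) => //; [exact: mp|move=> w; rewrite ger0_norm].
have c12 w : (c1 w - c2 w = Y w - m (C w))%R.
  by rewrite -[in RHS](pB (Y w)) -[in RHS](pB (m (C w))) /c1 /c2; ring.
have cE := weighted_eq (P := P) (c1 := c1) (c2 := c2) (th := C).
have {}cE : forall G : TC -> \bar R, measurable_fun setT G -> (forall x, 0 <= G x) ->
    \int[P]_w ((c1 w)%:E * G (C w)) = \int[P]_w ((c2 w)%:E * G (C w)).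
  apply: cE => //.
  - by apply: measurable_funD; exact: mp.
  - by apply: measurable_funD; exact: mp.
  - by move=> w; rewrite addr_ge0.
  - by move=> w; rewrite addr_ge0.
  - exact: integrable_lty.
  - move=> B mB; have mCB : measurable (C @^-1` B) by exact: measurable_preim.
    have iB f : P.-integrable setT f -> P.-integrable (C @^-1` B) f.
      by move=> ?; apply: (integrableS measurableT).
    rewrite (_ : \int[P]_(x in _) (c1 x)%:E = \int[P]_(w in C @^-1` B)
        ((c2 w)%:E + ((Y w)%:E - (m (C w))%:E))); last first.
      by apply: eq_integral => w _; rewrite -EFinB -EFinD -c12 addrC subrK.
    rewrite integralD//; [|exact: iB|by apply: integrableB => //; [exact: iYD|exact: iB]].
    rewrite integralB//; [|exact: iYD|exact: iB].
    by rewrite H// subee ?adde0// integrable_fin_num//; exact: iB.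
have bnd (f : Omega -> R) (D : set TC) : measurable D -> measurable_fun setT f ->
    (forall w, 0 <= f w)%R ->
    \int[P]_w (f w * (g (C w) * \1_D (C w)))%:E <= \int[P]_w (f w * g (C w))%:E.
  move=> mD mf f0; apply: ge0_le_integral => //.
  - by move=> w _; rewrite lee_fin !mulr_ge0.
  - apply/measurable_EFinP; apply: measurable_funM => //; apply: measurable_funM => //.
    by apply: (@measurableT_comp _ _ _ _ _ _ (\1_D : TC -> R) _ C).
  - by apply/measurable_EFinP; exact: measurable_funM.
  - move=> w _; rewrite lee_fin; apply: ler_wpM2l => //.
    by rewrite -[leRHS]mulr1; apply: ler_wpM2l.
have absY : \int[P]_w (`|Y w| * g (C w))%:E < +oo.
  have /integrableP[_] := iYg; congr (_ < _); apply: eq_integral => w _.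
  by rewrite abse_EFin normrM [X in (_ * X)%R]ger0_norm.
have leY (f : Omega -> R) : measurable_fun setT f -> (forall w, 0 <= f w <= `|Y w|)%R ->
    \int[P]_w (f w * g (C w))%:E < +oo.
  move=> mf f0; apply: le_lt_trans absY; apply: ge0_le_integral => //.
  - by move=> w _; rewrite lee_fin mulr_ge0//; case/andP: (f0 w).
  - by apply/measurable_EFinP; exact: measurable_funM.
  - by apply/measurable_EFinP; apply: measurable_funM => //; exact: measurableT_comp.
  - by move=> w _; rewrite lee_fin ler_wpM2r//; case/andP: (f0 w).
have mG D : measurable D -> measurable_fun setT (fun x => (g x * \1_D x)%:E).
  by move=> mD; apply/measurable_EFinP; exact: measurable_funM.
have G0 (D : set TC) x : 0 <= (g x * \1_D x)%:E by rewrite lee_fin mulr_ge0.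
have mi (f : Omega -> R) (D : set TC) : measurable D -> measurable_fun setT f ->
    measurable_fun setT (fun w => (f w * (g (C w) * \1_D (C w)))%:E).
  move=> mD mf; apply/measurable_EFinP; apply: measurable_funM => //.
  by apply: (@measurableT_comp _ _ _ _ _ _ (fun x => g x * \1_D x)%R _ C) => //;
    exact/measurable_EFinP/mG.
have mpos : \int[P]_w (p (m (C w)) * g (C w))%:E < +oo.
  apply: (@le_lt_trans _ _ (\int[P]_w (p (Y w) * g (C w))%:E)); last first.
    by apply: leY; [exact: mp|move=> w; rewrite p0 ple].
  apply: le_trans (bnd _ M mM (mp _ mY) (fun w => p0 _)).
  have e : \int[P]_w (p (Y w) * (g (C w) * \1_M (C w)))%:E =
      \int[P]_w ((c2 w)%:E * (g (C w) * \1_M (C w))%:E).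
    rewrite -(cE _ (mG _ mM) (G0 M)); apply: eq_integral => w _.
    rewrite -EFinM /c1 mulrDl; congr EFin; rewrite indicE.
    have [/set_mem w0|_] := boolP (C w \in M); last by rewrite !mulr0 addr0.
    rewrite (_ : p (- m (C w)) = 0)%R ?mul0r ?addr0//.
    by apply/max_idPr; rewrite oppr_le0.
  rewrite e; apply: ge0_le_integral => //.
  - by move=> w _; rewrite lee_fin mulr_ge0.
  - by apply/measurable_EFinP; apply: measurable_funM => //; exact: mp.
  - apply: (eq_measurable_fun (fun w => (c2 w * (g (C w) * \1_M (C w)))%:E)) => //.
    by apply: mi => //; apply: measurable_funD; exact: mp.
  - move=> w _; rewrite -EFinM lee_fin /c2 mulrDl indicE.
    have [_|/negP w0] := boolP (C w \in M); first by rewrite !mulr1 lerDr mulr_ge0.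
    rewrite (_ : p (m (C w)) = 0)%R ?mul0r ?addr0 ?mulr_ge0//.
    apply/max_idPr; rewrite leNgt; apply/negP => h; apply: w0.
    by apply/mem_set; exact: ltW.
have mneg : \int[P]_w (p (- m (C w)) * g (C w))%:E < +oo.
  have mMc := measurableC mM.
  apply: (@le_lt_trans _ _ (\int[P]_w (p (- Y w) * g (C w))%:E)); last first.
    by apply: leY; [exact: mp|move=> w; rewrite p0/= -normrN ple].
  apply: le_trans (bnd _ _ mMc (mp _ mNY) (fun w => p0 _)).
  have e : \int[P]_w (p (- Y w) * (g (C w) * \1_(~` M) (C w)))%:E =
      \int[P]_w ((c1 w)%:E * (g (C w) * \1_(~` M) (C w))%:E).
    rewrite (cE _ (mG _ mMc) (G0 (~` M))); apply: eq_integral => w _.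
    rewrite -EFinM /c2 mulrDl; congr EFin; rewrite indicE.
    have [/set_mem/negP|_] := boolP (C w \in ~` M); last by rewrite !mulr0 addr0.
    rewrite -ltNge => w0; rewrite (_ : p (m (C w)) = 0)%R ?mul0r ?addr0//.
    by apply/max_idPr; exact: ltW.
  rewrite e; apply: ge0_le_integral => //.
  - by move=> w _; rewrite lee_fin mulr_ge0.
  - by apply/measurable_EFinP; apply: measurable_funM => //; exact: mp.
  - apply: (eq_measurable_fun (fun w => (c1 w * (g (C w) * \1_(~` M) (C w)))%:E)) => //.
    by apply: mi => //; apply: measurable_funD; exact: mp.
  - move=> w _; rewrite -EFinM lee_fin /c1 mulrDl indicE.
    have [_|] := boolP (C w \in ~` M); first by rewrite !mulr1 lerDr mulr_ge0.
    rewrite in_setC negbK => /set_mem w0.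
    rewrite (_ : p (- m (C w)) = 0)%R ?mul0r ?addr0 ?mulr_ge0//.
    by apply/max_idPr; rewrite oppr_le0.
have img : P.-integrable setT (fun w => (m (C w) * g (C w))%:E).
  rewrite (_ : (fun w => _) = (fun w => (p (m (C w)) * g (C w))%:E -
    (p (- m (C w)) * g (C w))%:E)); last first.
    by apply/funext => w; rewrite -EFinB -mulrBl pB.
  apply: integrableB => //; apply/integrableP; split.
  - by apply/measurable_EFinP; apply: measurable_funM => //; exact: mp.
  - by under eq_integral do rewrite gee0_abs ?lee_fin ?mulr_ge0//.
  - by apply/measurable_EFinP; apply: measurable_funM => //; exact: mp.
  - by under eq_integral do rewrite gee0_abs ?lee_fin ?mulr_ge0//.
split=> //.
have icg (c : Omega -> R) : measurable_fun setT c -> (forall w, 0 <= c w <= `|Y w| + `|m (C w)|)%R ->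
    P.-integrable setT (fun w => (c w * g (C w))%:E).
  move=> mc c0; apply: (dom _ (fun w => `|Y w * g (C w)| + `|m (C w) * g (C w)|)%R).
  - exact: measurable_funM.
  - move=> w; rewrite [leRHS]ger0_norm ?addr_ge0// !normrM -mulrDl ler_wpM2r//.
    by have /andP[c00] := c0 w; rewrite ger0_norm.
  - under eq_fun do rewrite EFinD; apply: integrableD => //.
      by have := integrable_abse iYg; apply: eq_integrable.
    by have := integrable_abse img; apply: eq_integrable.
have mgE : measurable_fun setT (fun x => (g x)%:E) by exact/measurable_EFinP.
have e := cE _ mgE (fun x => _ : 0 <= (g x)%:E).
have {}e : \int[P]_w (c1 w * g (C w))%:E = \int[P]_w (c2 w * g (C w))%:E.
  by apply: e => x; rewrite lee_fin.
have ic1 : P.-integrable setT (fun w => (c1 w * g (C w))%:E).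
  apply: icg => [|w]; first by apply: measurable_funD; exact: mp.
  by rewrite addr_ge0//= lerD// -[leRHS]normrN ple.
have ic2 : P.-integrable setT (fun w => (c2 w * g (C w))%:E).
  apply: icg => [|w]; first by apply: measurable_funD; exact: mp.
  by rewrite addr_ge0//= lerD// -[leRHS]normrN ple.
(* The integrals of [c1] and [c2] against [g] are equal and finite, so adding their difference turns
   [m] into [Y] at no cost. *)
rewrite [RHS](_ : _ = \int[P]_w ((m (C w) * g (C w))%:E +
    ((c1 w * g (C w))%:E - (c2 w * g (C w))%:E))); last first.
  by apply: eq_integral => w _; rewrite -EFinB -EFinD -mulrBl -mulrDl c12 addrC subrK.
rewrite integralD//; last exact: integrableB.
by rewrite integralB// e subee ?adde0// integrable_fin_num.
Qed.

(** * Independent randomizers replaced by their means *)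

Section Randomization.
Context dV (S : measurableType dV) (nu : probability S R) (T : nat).
Variables (G : set (set Omega)) (V : nat -> Omega -> S).
(** The sample space seen through the variables other than [V]: being measurable on [OG] means being
    a function of those variables. *)
Let OG := g_sigma_algebraType G.
Variable phi : nat -> OG * S -> R.
Hypotheses (Gm : G `<=` measurable)
  (mV : forall t, (t < T)%N -> measurable_fun setT (V t))
  (mphi : forall t, (t < T)%N -> measurable_fun setT (phi t))
  (phi01 : forall t z, (0 <= phi t z <= 1)%R).
Hypothesis indep : forall (B : nat -> set S), (forall t, measurable (B t)) ->
   forall E, <<s G >> E ->
   P (E `&` \bigcap_(t in `I_T) (V t @^-1` B t)) =
   P E * \big[*%E/1%E]_(t < T) nu (B t).

Definition mean_phi t (w : OG) : R := fine (\int[nu]_v (phi t (w, v))%:E).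

Lemma mean_phi_bound t w : (t < T)%N ->
  0 <= \int[nu]_v (phi t (w, v))%:E <= 1.
Proof.
move=> tT; apply/andP; split.
  by apply: integral_ge0 => v _; rewrite lee_fin; have /andP[] := phi01 t (w, v).
rewrite -(@probability_setT _ _ _ nu) -[leRHS]mul1e -integral_cst//.
apply: ge0_le_integral => //.
- by move=> v _; rewrite lee_fin; have /andP[] := phi01 t (w, v).
- apply/measurable_EFinP.
  exact: (measurableT_comp (mphi tT) (pair1_measurable w)).
- by move=> v _; rewrite lee_fin; have /andP[] := phi01 t (w, v).
Qed.

Lemma mean_phiE t w : (t < T)%N ->
  (mean_phi t w)%:E = \int[nu]_v (phi t (w, v))%:E.
Proof.
move=> tT; have /andP[h0 h1] := mean_phi_bound w tT.
by rewrite /mean_phi fineK// ge0_fin_numE// (le_lt_trans h1)// ltry.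
Qed.

Lemma mean_phi01 t w : (t < T)%N -> (0 <= mean_phi t w <= 1)%R.
Proof. by move=> tT; rewrite -!lee_fin mean_phiE// mean_phi_bound. Qed.

Lemma measurable_mean_phi t : (t < T)%N -> measurable_fun setT (mean_phi t).
Proof.
move=> tT; apply/measurable_EFinP.
rewrite (_ : EFin \o _ = (fun w => \int[nu]_v (phi t (w, v))%:E)); last first.
  by apply/funext => w; rewrite -mean_phiE.
have mnu : measurable_fun setT (fun _ : OG => (nu : pprobability S R)).
  exact: measurable_cst.
apply: (measurable_integral_kernel (kprobability mnu) (g := fun z => (phi t z)%:E)).
by apply/measurable_EFinP; exact: mphi.
Qed.

Lemma measurable_prod_nat d' (S' : measurableType d') (a n : nat) (f : nat -> S' -> R) :
  (forall s, (a <= s < n)%N -> measurable_fun setT (f s)) ->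
  measurable_fun setT (fun w => \prod_(a <= s < n) f s w)%R.
Proof.
elim: n => [|n IH] mf.
  by under eq_fun do rewrite big_geq//; exact: measurable_cst.
have [an|na] := leqP a n; last first.
  by under eq_fun do rewrite big_geq//; exact: measurable_cst.
under eq_fun do rewrite big_nat_recr//=.
apply: measurable_funM; last by apply: mf; rewrite an ltnS leqnn.
by apply: IH => s /andP[h1 h2]; apply: mf; rewrite h1 ltnW.
Qed.

Lemma indic_bigcap_prod n (F : nat -> set Omega) w :
  \1_(\bigcap_(t in `I_n) F t) w = (\prod_(0 <= s < n) \1_(F s) w)%R :> R.
Proof.
elim: n => [|n IH]; first by rewrite big_geq// II0 bigcap_set0 indicT.
rewrite big_nat_recr//= -IH -[RHS]/((\1_(\bigcap_(t in `I_n) F t) \* \1_(F n))%R w).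
rewrite -indicI; congr (\1_ _ w); apply/seteqP; split => x.
  by move=> h; split => [t /= tn|]; apply: h => //=; exact: ltnW.
move=> [h1 h2] t /=; rewrite ltnS leq_eqVlt => /predU1P[->//|]; exact: h1.
Qed.

(* The uniforms are integrated out one at a time; those not yet treated occur
   only through events, so that rectangles reduce to the previous step. *)
Lemma randomization_indic j (B : nat -> set S) E : (j <= T)%N ->
  (forall t, measurable (B t)) -> <<s G >> E ->
  \int[P]_w (\1_E w * (\prod_(0 <= s < j) phi s (w, V s w) *
    \prod_(j <= s < T) \1_(B s) (V s w)))%:E =
  \int[P]_w (\1_E w * (\prod_(0 <= s < j) mean_phi s w *
    \prod_(j <= s < T) fine (nu (B s))))%:E.
Proof.
have mid := measurable_id_gsigma Gm.
have Esub A : <<s G >> A -> measurable A by move=> GA; rewrite -[A]setTI; exact: mid.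
elim: j B E => [|j IH] B E jT mB GE.
  transitivity (P (E `&` \bigcap_(t in `I_T) (V t @^-1` B t))).
    rewrite -[X in _ = P X]setIT -integral_indic//; last first.
      apply: measurableI; first exact: Esub.
      by apply: fin_bigcap_measurable => // t /= tT; exact: measurable_preim (mV tT) (mB t).
    apply: eq_integral => w _; rewrite big_geq// mul1r indicI /= indic_bigcap_prod.
    by congr (_ * _)%:E; apply: eq_bigr => s _; rewrite indic_preim.
  rewrite indep//.
  under [RHS]eq_integral do rewrite big_geq// mul1r EFinM muleC.
  rewrite ge0_integralZl//; last 2 first.
  - exact/measurable_EFinP/measurable_indic/Esub.
  - by rewrite lee_fin prodr_ge0// => s _; rewrite fine_ge0.
  rewrite integral_indic ?setIT//; last exact: Esub.
  rewrite [RHS]muleC; congr (_ * _).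
  rewrite (big_morph EFin EFinM erefl) big_mkord; apply: eq_bigr => s _.
  by rewrite fineK// fin_num_measure.
have mw s : (s < T)%N -> measurable_fun setT (fun w : Omega => phi s (w, V s w)).
  move=> sT; apply: (measurableT_comp (mphi sT)).
  by apply: measurable_fun_pair; [exact: mid|exact: mV].
have mr s : (s < T)%N -> measurable_fun setT (fun w : Omega => mean_phi s w).
  by move=> sT; apply: (measurableT_comp (measurable_mean_phi sT)); exact: mid.
pose c1 (w : Omega) := (\prod_(0 <= s < j) phi s (w, V s w) *
  \prod_(j.+1 <= s < T) \1_(B s) (V s w))%R.
pose c2 (w : Omega) := (\prod_(0 <= s < j) mean_phi s w *
  \prod_(j.+1 <= s < T) fine (nu (B s)))%R.
have mc1 : measurable_fun setT c1.
  apply: measurable_funM; apply: measurable_prod_nat => s /andP[h1 h2].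
    by apply: mw; apply: leq_trans jT; exact: ltnW.
  apply: (@measurableT_comp _ _ _ _ _ _ (\1_(B s) : S -> R) _ (V s)) => //.
  exact: mV.
have mc2 : measurable_fun setT c2.
  apply: measurable_funM; last exact: measurable_cst.
  apply: measurable_prod_nat => s /andP[h1 h2].
  by apply: mr; apply: leq_trans jT; exact: ltnW.
have c10 w : (0 <= c1 w)%R.
  by rewrite mulr_ge0// prodr_ge0// => s _; have /andP[] := phi01 s (w, V s w).
have c20 w : (0 <= c2 w)%R.
  rewrite mulr_ge0//; last by apply: prodr_ge0 => s _; rewrite fine_ge0.
  rewrite big_nat_cond; apply: prodr_ge0 => s /andP[/andP[h1 h2] _].
  have sT : (s < T)%N by apply: leq_trans jT; exact: ltnW.
  by have /andP[] := mean_phi01 w sT.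
have mnu : measurable_fun setT (fun _ : OG => (nu : pprobability S R)).
  exact: measurable_cst.
have mwV : measurable_fun setT (fun w : Omega => (w : OG, V j w)).
  by apply: measurable_fun_pair; [exact: mid|exact: mV].
have key (g : OG * S -> \bar R) : measurable_fun setT g -> (forall z, 0 <= g z) ->
    \int[P]_w ((c1 w)%:E * g (w, V j w)) =
    \int[P]_w ((c2 w)%:E * \int[nu]_v g (w, v)).
  apply: (posfun_eq_rect (posfun_weight P mc1 c10 mwV)
    (posfun_kernel P (kprobability mnu) mc2 c20 mid)).
    under eq_integral do rewrite mule1.
    apply: (@le_lt_trans _ _ (\int[P]_w 1)); last first.
      by rewrite integral_cst// mul1e (le_lt_trans (probability_le1 _ _))// ltry.
    apply: ge0_le_integral => //.
    - by move=> w _; rewrite lee_fin.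
    - exact/measurable_EFinP.
    move=> w _; rewrite lee_fin /c1 -[leRHS]mulr1 ler_pM//.
    - by rewrite prodr_ge0// => s _; have /andP[] := phi01 s (w, V s w).
    - by rewrite prodr_ge0.
    - by apply: prodr_ile1 => s _; exact: phi01.
    - by apply: prodr_ile1 => s _; rewrite indicE; case: (_ \in _); rewrite /= ?ler01 ?lexx.
  move=> A B' GA mB'.
  (* At stage [j] the variable [V j] still enters through an event, which may be any set: the
     rectangle A x B' is the induction hypothesis with [B j] replaced by [B'] and the event by
     [A]. *)
  pose B2 s := if s == j then B' else B s.
  have mB2 t : measurable (B2 t) by rewrite /B2; case: ifP.
  have e1 w : (\prod_(j <= s < T) \1_(B2 s) (V s w) =
      \1_B' (V j w) * \prod_(j.+1 <= s < T) \1_(B s) (V s w))%R.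
    rewrite big_ltn// {1}/B2 eqxx; congr (_ * _)%R; apply: eq_big_nat => s /andP[h _].
    by rewrite /B2 gtn_eqF.
  have e2 : (\prod_(j <= s < T) fine (nu (B2 s)) =
      fine (nu B') * \prod_(j.+1 <= s < T) fine (nu (B s)))%R.
    rewrite big_ltn// {1}/B2 eqxx; congr (_ * _)%R; apply: eq_big_nat => s /andP[h _].
    by rewrite /B2 gtn_eqF.
  transitivity (\int[P]_w (\1_A w * (\prod_(0 <= s < j) phi s (w, V s w) *
      \prod_(j <= s < T) \1_(B2 s) (V s w)))%:E).
    by apply: eq_integral => w _; rewrite /= -EFinM e1; congr EFin; rewrite /c1; ring.
  rewrite IH//; last exact: ltnW.
  apply: eq_integral => w _ /=; rewrite e2.
  under eq_integral do rewrite EFinM.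
  rewrite ge0_integralZl//; last exact/measurable_EFinP/measurable_indic.
  rewrite integral_indic// setIT -[X in _ * (_ * X)]fineK ?fin_num_measure// -!EFinM.
  by congr EFin; rewrite /c2; ring.
transitivity (\int[P]_w ((c1 w)%:E * (\1_E w * phi j (w, V j w))%:E)).
  apply: eq_integral => w _; rewrite -EFinM big_nat_recr//=; congr EFin.
  by rewrite /c1; ring.
rewrite (key (fun z => (\1_E z.1 * phi j z)%:E)); last 2 first.
- apply/measurable_EFinP; apply: measurable_funM; last exact: mphi.
  by apply: (@measurableT_comp _ _ _ _ _ _ (\1_E : OG -> R) _ fst).
- by move=> z; rewrite lee_fin mulr_ge0//; have /andP[] := phi01 j z.
apply: eq_integral => w _; under eq_integral do rewrite /= EFinM.
rewrite ge0_integralZl//; last 2 first.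
- apply/measurable_EFinP.
  exact: (measurableT_comp (mphi jT) (pair1_measurable (w : OG))).
- by move=> v _; rewrite lee_fin; have /andP[] := phi01 j (w, v).
rewrite -mean_phiE// -!EFinM big_nat_recr//=; congr EFin.
by rewrite /c2; ring.
Qed.

(** Taking the whole space as the event for the variables from [n] on removes them; the two products
    are then densities that agree on every event of [OG], hence on every [c]. *)
Lemma randomization n (c : OG -> \bar R) : (n <= T)%N ->
  measurable_fun setT c -> (forall w, 0 <= c w) ->
  \int[P]_w ((\prod_(0 <= s < n) phi s (w, V s w))%:E * c w) =
  \int[P]_w ((\prod_(0 <= s < n) mean_phi s w)%:E * c w).
Proof.
move=> nT.
have mid := measurable_id_gsigma Gm.
have ltT s : (0 <= s < n)%N -> (s < T)%N by move=> /= h; exact: leq_trans nT.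
apply: (weighted_eq (P := P) (th := id : Omega -> OG)) => //.
- apply: measurable_prod_nat => s /ltT sT; apply: (measurableT_comp (mphi sT)).
  by apply: measurable_fun_pair; [exact: mid|exact: mV].
- apply: measurable_prod_nat => s /ltT sT.
  by apply: (measurableT_comp (measurable_mean_phi sT)); exact: mid.
- by move=> w; apply: prodr_ge0 => s _; have /andP[] := phi01 s (w, V s w).
- move=> w; rewrite big_nat_cond; apply: prodr_ge0 => s /andP[/ltT sT _].
  by have /andP[] := mean_phi01 w sT.
- apply: (@le_lt_trans _ _ (\int[P]_w 1)); last first.
    by rewrite integral_cst// mul1e (le_lt_trans (probability_le1 _ _))// ltry.
  apply: ge0_le_integral => //.
  + by move=> w _; rewrite lee_fin; apply: prodr_ge0 => s _; have /andP[] := phi01 s (w, V s w).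
  + apply/measurable_EFinP.
    apply: measurable_prod_nat => s /ltT sT; apply: (measurableT_comp (mphi sT)).
    by apply: measurable_fun_pair; [exact: mid|exact: mV].
  + by move=> w _; rewrite lee_fin; apply: prodr_ile1 => s _; exact: phi01.
- move=> E GE; have := @randomization_indic n (fun=> setT) E nT (fun=> measurableT) GE.
  have e1 w : (\prod_(n <= s < T) \1_[set: S] (V s w) = 1 :> R)%R.
    by rewrite big1// => s _; rewrite indicT.
  have e2 : (\prod_(n <= s < T) fine (nu [set: S]) = 1 :> R)%R.
    by rewrite big1// => s _; rewrite probability_setT.
  rewrite e2; under eq_integral do rewrite e1 mulr1 mulrC EFinM.
  under [X in _ = X -> _]eq_integral do rewrite mulr1 mulrC EFinM.
  by move=> h; rewrite [LHS]integral_set_indic h [RHS]integral_set_indic.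
Qed.
End Randomization.
End DisintegrationAndRandomization.

(** * Histories and trajectories *)

Section HistoryLemmas.
Context (R : realType) (d T : nat).
Local Notation hist := (Hist R d T).
Local Notation xcov := (Xcov R d).
Implicit Types (h : hist) (x : xcov) (b : bool).

Lemma hist_ext h h' : (forall i, tnth h.1 i = tnth h'.1 i) ->
  (forall i, tnth h.2 i = tnth h'.2 i) -> h = h'.
Proof.
by case: h h' => [h1 h2] [h1' h2'] /= e1 e2; congr pair; apply: eq_from_tnth.
Qed.

(** The equation [histX k h = h] is the way to say that [h] records nothing from time [k] on. *)
Lemma histX_tnth k h : histX k h = h -> forall i : 'I_T, (k <= i)%N ->
  tnth h.1 i = xdef R d /\ tnth h.2 i = false.
Proof.
by move=> e i ki; split; rewrite -e /= tnth_mktuple ltnNge ki.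
Qed.

Lemma histX_hist0 : histX 0 hist0 = hist0 :> hist.
Proof. by apply: hist_ext => i; rewrite /= !tnth_mktuple. Qed.

Lemma histX_setXA j k x b h : (j <= k)%N ->
  histX j (setAh k b (setXh k x h)) = histX j h.
Proof.
move=> jk; apply: hist_ext => i; rewrite /= !tnth_mktuple; case: ifP => // ij;
  by rewrite ?tnth_mktuple ltn_eqF// (leq_trans ij).
Qed.

Lemma histA_setXA j k x b h : (j < k)%N ->
  histA j (setAh k b (setXh k x h)) = histA j h.
Proof.
move=> jk; apply: hist_ext => i; rewrite /= !tnth_mktuple; case: ifP => // ij.
  by rewrite ?tnth_mktuple ltn_eqF// (leq_trans ij).
by rewrite ltn_eqF// (leq_trans ij)// ltnW.
Qed.

Lemma histA_setX j k x h : (j < k)%N -> histA j (setXh k x h) = histA j h.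
Proof.
move=> jk; apply: hist_ext => i; rewrite /= !tnth_mktuple//; case: ifP => // ij.
by rewrite ltn_eqF// (leq_trans ij).
Qed.

Lemma histA_setX_id k x h : histX k h = h -> histA k (setXh k x h) = setXh k x h.
Proof.
move=> wf; apply: hist_ext => i; rewrite /= !tnth_mktuple.
  case: (ltngtP i k) => [ik|ki|->]; rewrite ?eqxx ?leqnn //.
    by rewrite ltnS ltnW.
  by rewrite ltnS leqNgt ki /=; have [->] := histX_tnth wf (ltnW ki).
by case: ltnP => // ki; have [_ ->] := histX_tnth wf ki.
Qed.

Lemma histA_setXA_id k x b h : histX k h = h ->
  histA k (setAh k b (setXh k x h)) = setXh k x h.
Proof.
move=> wf; rewrite -[RHS]histA_setX_id//; apply: hist_ext => i;
  rewrite /= !tnth_mktuple//.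
by case: ifP => // ik; rewrite ltn_eqF.
Qed.

Lemma histX_setXA_id k x b h : histX k h = h ->
  histX k.+1 (setAh k b (setXh k x h)) = setAh k b (setXh k x h).
Proof.
move=> wf; apply: hist_ext => i; rewrite /= !tnth_mktuple.
  case: (ltngtP i k) => [ik|ki|->]; rewrite ?eqxx ?leqnn //.
    by rewrite ltnS ltnW.
  by rewrite ltnS leqNgt ki /=; have [->] := histX_tnth wf (ltnW ki).
case: (ltngtP i k) => [ik|ki|->]; rewrite ?eqxx ?leqnn //.
  by rewrite ltnS ltnW.
by rewrite ltnS leqNgt ki /=; have [_ ->] := histX_tnth wf (ltnW ki).
Qed.

Lemma Aof_setA k b h : (k < T)%N -> Aof k (setAh k b h) = b.
Proof.
by move=> kT; rewrite /Aof /= (nth_mktuple _ _ (Ordinal kT)) /= eqxx.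
Qed.

Lemma Aof_setA_neq s k b h : s != k -> Aof s (setAh k b h) = Aof s h.
Proof.
move=> sk; rewrite /Aof; have [sT|Ts] := ltnP s T; last first.
  by rewrite !nth_default ?size_tuple.
by rewrite /= (nth_mktuple _ _ (Ordinal sT)) /= (negbTE sk) (tnth_nth false).
Qed.

Lemma Xof_setX k x h : (k < T)%N -> Xof k (setXh k x h) = x.
Proof.
by move=> kT; rewrite /Xof /= (nth_mktuple _ _ (Ordinal kT)) /= eqxx.
Qed.

Lemma Xof_setX_neq s k x h : s != k -> Xof s (setXh k x h) = Xof s h.
Proof.
move=> sk; rewrite /Xof; have [sT|Ts] := ltnP s T; last first.
  by rewrite !nth_default ?size_tuple.
by rewrite /= (nth_mktuple _ _ (Ordinal sT)) /= (negbTE sk) (tnth_nth (xdef R d)).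
Qed.

Section Trajectories.
Variables (gX : nat -> hist -> xcov) (gA : nat -> hist -> bool).
Local Notation tr := (traj gX gA).

(** The history H_k along the trajectory. No truncation appears, since [tr k] holds only defaults
    from time [k] on. *)
Definition preA k : hist := setXh k (gX k (tr k)) (tr k).

Lemma histX_traj_id k : histX k (tr k) = tr k.
Proof.
by elim: k => [|k IH]; [exact: histX_hist0|rewrite /= histX_setXA_id].
Qed.

(** The truncations in the recursion act trivially on histories that it has generated itself. *)
Lemma trajS k : tr k.+1 = setAh k (gA k (preA k)) (preA k).
Proof. by rewrite /= histX_traj_id histA_setX_id// histX_traj_id. Qed.

Lemma histX_traj k n : (k <= n)%N -> histX k (tr n) = tr k.
Proof.
elim: n => [|n IH]; first by rewrite leqn0 => /eqP->; exact: histX_hist0.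
rewrite leq_eqVlt => /predU1P[->|]; first exact: histX_traj_id.
by rewrite ltnS => kn; rewrite trajS histX_setXA// IH.
Qed.

Lemma histA_traj k n : (k < n)%N -> histA k (tr n) = preA k.
Proof.
elim: n => // n IH; rewrite ltnS leq_eqVlt => /predU1P[->|kn].
  by rewrite trajS histA_setXA_id// histX_traj_id.
by rewrite trajS histA_setXA// IH.
Qed.

Lemma Aof_traj k n : (k < n)%N -> (k < T)%N -> Aof k (tr n) = gA k (preA k).
Proof.
move=> + kT; elim: n => // n IH; rewrite ltnS leq_eqVlt => /predU1P[<-|kn].
  by rewrite trajS Aof_setA.
by rewrite trajS Aof_setA_neq ?ltn_eqF// -[LHS]/(Aof k (tr n)) IH.
Qed.

Lemma Xof_traj k n : (k < n)%N -> (k < T)%N -> Xof k (tr n) = gX k (tr k).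
Proof.
move=> + kT; elim: n => // n IH; rewrite ltnS leq_eqVlt => /predU1P[e|kn].
  by rewrite trajS -e -[LHS]/(Xof k (preA k)) Xof_setX.
by rewrite trajS -[LHS]/(Xof k (preA n)) Xof_setX_neq ?ltn_eqF// IH.
Qed.
End Trajectories.

(** Agreement is required only at the histories visited by the first rule. This is what allows a
    flip trajectory to be replaced by a forced one on the event that they have agreed so far. *)
Lemma traj_ext gX (gA gA' : nat -> hist -> bool) n :
  (forall k, (k < n)%N -> gA k (preA gX gA k) = gA' k (preA gX gA k)) ->
  traj gX gA n = traj gX gA' n.
Proof.
elim: n => // n IH e; rewrite !trajS -[preA gX gA' n]/(setXh _ _ _).
rewrite -IH; last by move=> k kn; apply: e; exact: ltnW.
by rewrite -/(preA gX gA n) e.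
Qed.

Section Measurability.
Context (dS : measure_display) (S : measurableType dS).

Lemma measurable_hist (f : S -> T.-tuple xcov) (g : S -> T.-tuple bool) :
  (forall i, measurable_fun setT (fun w => tnth (f w) i)) ->
  (forall i, measurable_fun setT (fun w => tnth (g w) i)) ->
  measurable_fun setT (fun w => (f w, g w) : hist).
Proof.
by move=> mf mg; apply: measurable_fun_pair; apply/measurable_fun_tnthP.
Qed.

Lemma measurable_tnthX (f : S -> hist) i : measurable_fun setT f ->
  measurable_fun setT (fun w => tnth (f w).1 i).
Proof.
move=> mf; apply: (@measurableT_comp _ _ _ _ _ _ (fun h : hist => tnth h.1 i) _ f) => //.
exact: (measurableT_comp (measurable_tnth i) measurable_fst).
Qed.

Lemma measurable_tnthA (f : S -> hist) i : measurable_fun setT f ->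
  measurable_fun setT (fun w => tnth (f w).2 i).
Proof.
move=> mf; apply: (@measurableT_comp _ _ _ _ _ _ (fun h : hist => tnth h.2 i) _ f) => //.
exact: (measurableT_comp (measurable_tnth i) measurable_snd).
Qed.

Lemma measurable_setXh n (x : S -> xcov) (f : S -> hist) :
  measurable_fun setT x -> measurable_fun setT f ->
  measurable_fun setT (fun w => setXh n (x w) (f w)).
Proof.
move=> mx mf; apply: measurable_hist => i; last exact: measurable_tnthA.
under eq_fun do rewrite tnth_mktuple.
by case: (nat_of_ord i == n) => //; exact: measurable_tnthX.
Qed.

Lemma measurable_setAh n (b : S -> bool) (f : S -> hist) :
  measurable_fun setT b -> measurable_fun setT f ->
  measurable_fun setT (fun w => setAh n (b w) (f w)).
Proof.
move=> mb mf; apply: measurable_hist => i; first exact: measurable_tnthX.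
under eq_fun do rewrite tnth_mktuple.
by case: (nat_of_ord i == n) => //; exact: measurable_tnthA.
Qed.

Lemma measurable_trunc nx na (f : S -> hist) : measurable_fun setT f ->
  measurable_fun setT (fun w => trunc nx na (f w)).
Proof.
move=> mf; apply: measurable_hist => i; under eq_fun do rewrite tnth_mktuple.
  by case: (i < nx)%N; [exact: measurable_tnthX|exact: measurable_cst].
by case: (i < na)%N; [exact: measurable_tnthA|exact: measurable_cst].
Qed.

Lemma measurable_Aof t (f : S -> hist) : measurable_fun setT f ->
  measurable_fun setT (fun w => Aof t (f w)).
Proof.
move=> mf; rewrite /Aof; have [tT|Tt] := ltnP t T; last first.
  by under eq_fun do rewrite nth_default ?size_tuple//; exact: measurable_cst.
under eq_fun do rewrite -(tnth_nth false _ (Ordinal tT)).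
exact: measurable_tnthA.
Qed.

Lemma measurable_Xof t (f : S -> hist) : measurable_fun setT f ->
  measurable_fun setT (fun w => Xof t (f w)).
Proof.
move=> mf; rewrite /Xof; have [tT|Tt] := ltnP t T; last first.
  by under eq_fun do rewrite nth_default ?size_tuple//; exact: measurable_cst.
under eq_fun do rewrite -(tnth_nth (xdef R d) _ (Ordinal tT)).
exact: measurable_tnthX.
Qed.
End Measurability.
End HistoryLemmas.

(** * Forced continuations of a trajectory *)

Section Model.
Context (R : realType) (d T : nat).
Context (dX dA : nat -> measure_display) (dY : measure_display)
  (UXT : forall t, measurableType (dX t)) (UAT : forall t, measurableType (dA t))
  (UYT : measurableType dY).
Local Notation hist := (Hist R d T).
Variables (fX : forall t, (hist * UXT t)%type -> Xcov R d)
  (fA : forall t, (hist * UAT t)%type -> bool).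
Hypotheses (mfX : forall t, (t < T)%N -> measurable_fun setT (@fX t))
  (mfA : forall t, (t < T)%N -> measurable_fun setT (@fA t)).

Section Continuation.
Context (dS : measure_display) (S : measurableType dS).
Variables (uX : forall t, S -> UXT t) (uA : forall t, S -> UAT t) (uY : S -> UYT).
Variables (b : nat -> bool) (rho : nat -> bool -> hist -> R)
  (G : hist * UYT -> \bar R).

(* Outcome [G] reached by playing [b] from time [k] on, starting from the
   history [h], weighted by the factors [rho s (natural treatment at s)]. *)
Fixpoint continuation (m k : nat) (h : hist) (w : S) : \bar R :=
  match m with
  | 0 => G (h, uY w)
  | m'.+1 =>
      let h1 := setXh k (fX (h, @uX k w)) h in
      ((rho k (fA (h1, @uA k w)) h1)%:E *
       continuation m' k.+1 (setAh k (b k) h1) w)%E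
  end.

Lemma continuation_ge0 m k h w : (k + m <= T)%N ->
  (forall s c h, (s < T)%N -> 0 <= rho s c h) ->
  (forall z, 0 <= G z)%E -> (0 <= continuation m k h w)%E.
Proof.
move=> + r0 G0; elim: m k h => //= m IH k h kmT.
rewrite mule_ge0 ?lee_fin//; last by apply: IH; rewrite addSnnS.
by apply: r0; apply: leq_trans kmT; rewrite addnS ltnS leq_addr.
Qed.

(** The space [S] is arbitrary and only the noise of times [k] to [k + m - 1] and the outcome noise
    are involved, so the result applies to the sigma-algebra generated by the future noise alone. *)
Lemma measurable_continuation m k : (k + m <= T)%N ->
  (forall s, (k <= s < k + m)%N -> measurable_fun setT (@uX s)) ->
  (forall s, (k <= s < k + m)%N -> measurable_fun setT (@uA s)) ->
  measurable_fun setT uY ->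
  (forall s c, (s < T)%N -> measurable_fun setT (rho s c)) ->
  measurable_fun setT G ->
  measurable_fun setT (fun z : hist * S => continuation m k z.1 z.2).
Proof.
elim: m k => [|m IH] k kmT muX muA muY mrho mG.
  rewrite /=; apply: (measurableT_comp mG); apply: measurable_fun_pair => //.
  exact: measurableT_comp.
have kT : (k < T)%N by apply: leq_trans kmT; rewrite addnS ltnS leq_addr.
have kk : (k <= k < k + m.+1)%N by rewrite leqnn addnS ltnS leq_addr.
have mh1 : measurable_fun setT (fun z : hist * S => setXh k (fX (z.1, @uX k z.2)) z.1).
  apply: measurable_setXh => //; apply: (measurableT_comp (mfX kT)).
  apply: measurable_fun_pair => //.
  by apply: measurableT_comp => //; exact: muX.
rewrite /=; apply: emeasurable_funM.
  apply/measurable_EFinP.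
  rewrite (_ : (fun z => _) = (fun z : hist * S =>
     let h1 := setXh k (fX (z.1, @uX k z.2)) z.1 in
     if fA (h1, @uA k z.2) then rho k true h1 else rho k false h1)); last first.
    by apply/funext => z /=; case: (fA _).
  apply: measurable_fun_ifT.
  - apply: (measurableT_comp (mfA kT)); apply: measurable_fun_pair => //.
    by apply: measurableT_comp => //; exact: muA.
  - by apply: (measurableT_comp (mrho k true kT)).
  - by apply: (measurableT_comp (mrho k false kT)).
apply: (@measurableT_comp _ _ _ _ _ _ (fun z : hist * S => continuation m k.+1 z.1 z.2) _
   (fun z : hist * S => (setAh k (b k) (setXh k (fX (z.1, @uX k z.2)) z.1), z.2))).
  apply: IH => //; first by rewrite addSnnS.
  - by move=> s /andP[h1 h2]; apply: muX; rewrite ltnW//= -addSnnS.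
  - by move=> s /andP[h1 h2]; apply: muA; rewrite ltnW//= -addSnnS.
apply: measurable_fun_pair => //.
exact: measurable_setAh.
Qed.

Lemma measurable_traj (gA : nat -> hist -> S -> bool) n : (n <= T)%N ->
  (forall s, (s < n)%N -> measurable_fun setT (@uX s)) ->
  (forall s, (s < n)%N -> measurable_fun setT (fun z : hist * S => gA s z.1 z.2)) ->
  measurable_fun setT (fun w => traj (fun t h => @fX t (h, @uX t w)) (fun t h => gA t h w) n).
Proof.
elim: n => [|n IH] nT muX mgA; first exact: measurable_cst.
have mtr := IH (ltnW nT) (fun s sn => muX s (ltnW sn)) (fun s sn => mgA s (ltnW sn)).
have mpre : measurable_fun setT (fun w => preA (fun t h => @fX t (h, @uX t w))
    (fun t h => gA t h w) n).
  apply: measurable_setXh => //; apply: (measurableT_comp (mfX nT)).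
  by apply: measurable_fun_pair => //; exact: muX.
under eq_fun do rewrite trajS.
apply: measurable_setAh => //.
apply: (@measurableT_comp _ _ _ _ _ _ (fun z : hist * S => gA n z.1 z.2) _
  (fun w => (preA (fun t h => @fX t (h, @uX t w)) (fun t h => gA t h w) n, w))).
  exact: mgA.
exact: measurable_fun_pair.
Qed.

Lemma measurable_preA (gA : nat -> hist -> S -> bool) n : (n < T)%N ->
  (forall s, (s <= n)%N -> measurable_fun setT (@uX s)) ->
  (forall s, (s < n)%N -> measurable_fun setT (fun z : hist * S => gA s z.1 z.2)) ->
  measurable_fun setT (fun w => preA (fun t h => @fX t (h, @uX t w)) (fun t h => gA t h w) n).
Proof.
move=> nT muX mgA; have mtr := measurable_traj (ltnW nT) (fun s sn => muX s (ltnW sn)) mgA.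
apply: measurable_setXh => //; apply: (measurableT_comp (mfX nT)).
by apply: measurable_fun_pair => //; exact: muX.
Qed.

(** On a path that has played [b] throughout, the recursion meets exactly the histories of the
    forced trajectory and unrolls into one product; at [k = 0] this is the form left once the
    uniforms are integrated out. *)
Lemma continuation_prod m k w :
  let gX t h := @fX t (h, @uX t w) in
  continuation m k (traj gX (fun t _ => b t) k) w =
  ((\prod_(k <= s < k + m) rho s (fA (preA gX (fun t _ => b t) s, @uA s w))
      (preA gX (fun t _ => b t) s))%:E *
   G (traj gX (fun t _ => b t) (k + m), uY w))%E.
Proof.
move=> gX; elim: m k => [|m IH] k; first by rewrite addn0 big_geq// mul1e.
rewrite big_ltn ?addnS ?ltnS ?leq_addr// EFinM -muleA /=; congr (_ * _)%E.
by have := IH k.+1; rewrite trajS addSn => ->.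
Qed.

End Continuation.
End Model.

(** * Exchanging the natural treatment for its conditional law *)

Section MeasurableReal.
Context (R : realType).

(** Inversion is continuous off 0, and the single point 0 is treated apart. *)
Lemma measurable_invr : measurable_fun setT (@GRing.inv R).
Proof.
rewrite -(setvU [set 0 : R]); apply/measurable_funU; [|by []|split].
- exact: measurableC.
- apply: open_continuous_measurable_fun => [|x].
    by apply: closed_openC; exact: closed_eq.
  by rewrite inE /= => /eqP x0; exact: inv_continuous.
- exact: measurable_fun_set1.
Qed.

Lemma measurable_eqb_natr dS (S : measurableType dS) (f : S -> bool) (c : bool) :
  measurable_fun setT f -> measurable_fun setT (fun w => (f w == c)%:R : R).
Proof.
move=> mf; rewrite (_ : (fun w => _) =
  (fun w => if f w then (true == c)%:R else (false == c)%:R : R)); last first.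
  by apply/funext => w; case: (f w).
by apply: measurable_fun_ifT.
Qed.
End MeasurableReal.

(* No integrability is needed: when both parts are infinite, the convention
   [+oo - +oo = -oo] gives [-oo] on both sides for [c > 0]. *)
Lemma integralZl_ge0 (R : realType) dS (S : measurableType dS)
    (mu : {measure set S -> \bar R}) (c : R) (f : S -> \bar R) : 0 <= c ->
  measurable_fun setT f ->
  (\int[mu]_x (c%:E * f x) = c%:E * \int[mu]_x f x)%E.
Proof.
move=> c0 mf; rewrite integralE [in RHS]integralE ge0_funeposM// ge0_funenegM//.
rewrite !ge0_integralZl_EFin//; [|exact: measurable_funeneg|exact: measurable_funepos].
move: c0; rewrite le_eqVlt => /predU1P[<-|c0]; first by rewrite !mul0e sube0.
have := integral_ge0 mu (fun x (_ : setT x) => funepos_ge0 f x).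
have := integral_ge0 mu (fun x (_ : setT x) => funeneg_ge0 f x).
move: (\int[mu]_x f^\- x)%E (\int[mu]_x f^\+ x)%E => [n||] [p||] // _ _.
- by rewrite muleBr.
- by rewrite addye// gt0_muley ?lte_fin// addye.
- by rewrite gt0_muley ?lte_fin//= addeNy addeNy gt0_muleNy ?lte_fin.
- by rewrite gt0_muley ?lte_fin//= gt0_muleNy ?lte_fin.
Qed.

Section Identification.
Context (R : realType) (d T : nat)
  (dO : measure_display) (Omega : measurableType dO) (P : probability Omega R)
  (dX dA : nat -> measure_display) (dY : measure_display)
  (UXT : forall t, measurableType (dX t)) (UAT : forall t, measurableType (dA t))
  (UYT : measurableType dY).
Local Notation hist := (Hist R d T).
Variables (fX : forall t, (hist * UXT t)%type -> Xcov R d)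
  (fA : forall t, (hist * UAT t)%type -> bool)
  (UX : forall t, Omega -> UXT t) (UA : forall t, Omega -> UAT t) (UY : Omega -> UYT)
  (a : nat -> bool) (ff : nat -> hist -> R) (pi : nat -> hist -> R).
Hypotheses (mfX : forall t, (t < T)%N -> measurable_fun setT (@fX t))
  (mfA : forall t, (t < T)%N -> measurable_fun setT (@fA t))
  (mUX : forall t, (t < T)%N -> measurable_fun setT (@UX t))
  (mUA : forall t, (t < T)%N -> measurable_fun setT (@UA t))
  (mUY : measurable_fun setT UY)
  (mff : forall t, (t < T)%N -> measurable_fun setT (ff t))
  (ff01 : forall t h, (t < T)%N -> 0 <= ff t h <= 1).
Hypothesis rand : forall t, (t < T)%N ->
  condIndep P (@UA t) (futureU_events T UX UA UY t) (Hobs fX fA UX UA t).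
Hypothesis cepi : forall t, (t < T)%N ->
  isCondExp P (\1_[set w | Aobs fX fA UX UA t w = a t])
    (Hobs fX fA UX UA t) (pi t).
Hypothesis positivity : forall t, (t < T)%N ->
     P [set w | pi t (Hobs fX fA UX UA t w) = 0 ->
                ff t (Hobs fX fA UX UA t w) = 0] = 1%E \/
     P [set w | pi t (Hobs fX fA UX UA t w) = 0] = 0%E.

Local Notation Q := (Qw a ff pi).
Local Notation prop := (propw a pi).
Local Notation H := (Hobs fX fA UX UA).
Local Notation gX w := (fun t h => @fX t (h, @UX t w)).
Local Notation gA w := (fun t h => @fA t (h, @UA t w)).
Local Notation tr w := (traj (gX w) (gA w)).
Local Notation pre w := (preA (gX w) (gA w)).

Lemma HobsE k w : (k < T)%N -> H k w = pre w k.
Proof. exact: histA_traj. Qed.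

Lemma HXobsE k w : (k <= T)%N -> HXobs fX fA UX UA k w = tr w k.
Proof. exact: histX_traj. Qed.

Lemma AobsE k w : (k < T)%N -> Aobs fX fA UX UA k w = fA (H k w, UA k w).
Proof. by move=> kT; rewrite HobsE// /Aobs Aof_traj. Qed.

Lemma measurable_tr k : (k <= T)%N -> measurable_fun setT (fun w => tr w k).
Proof.
move=> kT; apply: (measurable_traj mfX (uX := UX) (gA := fun s h w => fA (h, UA s w)) kT) => s sk.
  by apply: mUX; exact: leq_trans kT.
have sT := leq_trans sk kT.
apply: (measurableT_comp (mfA sT)); apply: measurable_fun_pair => //.
by apply: measurableT_comp => //; exact: mUA.
Qed.

Lemma measurable_Hobs k : (k < T)%N -> measurable_fun setT (H k).
Proof. by move=> kT; apply: measurable_trunc; exact: measurable_tr. Qed.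

Lemma measurable_pi t : (t < T)%N -> measurable_fun setT (pi t).
Proof. by move=> tT; have [] := cepi tT. Qed.

Lemma measurable_prop t c : (t < T)%N -> measurable_fun setT (prop t c).
Proof.
move=> tT; rewrite /propw; case: (c == a t); first exact: measurable_pi.
by apply: measurable_funB => //; exact: measurable_pi.
Qed.

Lemma measurable_Q t c : (t < T)%N -> measurable_fun setT (Q t c).
Proof.
move=> tT; have mp := measurable_pi tT.
have mq : measurable_fun setT (fun h => pi t h + ff t h * (1 - pi t h)).
  apply: measurable_funD => //; apply: measurable_funM; first exact: mff.
  exact: measurable_funB.
rewrite /Qw; case: (c == a t) => //.
exact: measurable_funB.
Qed.

(* The absolute value acts only on a null set, where the version [pi] may leave
   [0, 1]; it keeps all weights nonnegative everywhere. *)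
Definition ratio t c h : R := `|Q t c h / prop t c h|.

Lemma measurable_ratio t c : (t < T)%N -> measurable_fun setT (ratio t c).
Proof.
move=> tT; apply: (measurableT_comp (@normr_measurable R setT)).
apply: measurable_funM; first exact: measurable_Q.
apply: (@measurableT_comp _ _ _ _ _ _ (@GRing.inv R) _ (prop t c)).
  exact: measurable_invr.
exact: measurable_prop.
Qed.

Lemma ae_of_measure0 (A : set Omega) : measurable A -> P (~` A) = 0%E ->
  \forall w \ae P, A w.
Proof. by move=> mA PA; apply/negligibleP => //; exact: measurableC. Qed.

(** The upper bound holds because 1 - pi is a version of the complementary probability. Both
    positivity alternatives give the same almost sure implication, the second one vacuously. *)
Lemma ae_support t : (t < T)%N -> \forall w \ae P,
  [/\ 0 <= pi t (H t w), pi t (H t w) <= 1 & pi t (H t w) = 0 -> ff t (H t w) = 0].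
Proof.
move=> tT; have mH := measurable_Hobs tT.
have mAe : measurable [set w | Aobs fX fA UX UA t w = a t].
  have mA : measurable_fun setT (Aobs fX fA UX UA t).
    by apply: measurable_Aof; exact: measurable_tr.
  by rewrite -[X in measurable X]setTI; apply: (mA measurableT [set a t]).
have h1 : \forall w \ae P, 0 <= pi t (H t w).
  by apply: (isCondExp_ae_ge0 mH _ (cepi tT)).
have h2 : \forall w \ae P, 0 <= 1 - pi t (H t w).
  by apply: (isCondExp_ae_ge0 mH _ (isCondExp_compl mH mAe (cepi tT))).
have m0 (f : hist -> R) : measurable_fun setT f -> measurable [set w | f (H t w) = 0].
  move=> mf; have mfH : measurable_fun setT (fun w => f (H t w)).
    exact: measurableT_comp.
  by rewrite -[X in measurable X]setTI; apply: (mfH measurableT [set 0]).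
have mpi0 := m0 _ (measurable_pi tT); have mff0 := m0 _ (mff tT).
have mimp : measurable [set w | pi t (H t w) = 0 -> ff t (H t w) = 0].
  rewrite (_ : [set w | _] = ~` [set w | pi t (H t w) = 0] `|` [set w | ff t (H t w) = 0]).
    by apply: measurableU => //; exact: measurableC.
  apply/seteqP; split => w /=; last by move=> [].
  by move=> h; have [e|ne] := pselect (pi t (H t w) = 0); [right; exact: h|left].
have h3 : \forall w \ae P, pi t (H t w) = 0 -> ff t (H t w) = 0.
  have [P1|P0] := positivity tT.
    by apply: (ae_of_measure0 mimp); rewrite probability_setC// P1 subee.
  have : \forall w \ae P, (~` [set w | pi t (H t w) = 0]) w.
    by apply: ae_of_measure0; [exact: measurableC|rewrite setCK].
  by apply: filterS => w.
by apply: filterS3 h1 h2 h3 => w; rewrite subr_ge0.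
Qed.

(** Division by zero returns 0, so [Q] must vanish wherever [prop] does: at the target treatment
    because pi = 0 forces f = 0, at the other one because [Q] is the product of 1 - f and 1 - pi. *)
Lemma ae_ratio t : (t < T)%N -> \forall w \ae P, forall c,
  [/\ 0 <= prop t c (H t w), 0 <= Q t c (H t w),
      ratio t c (H t w) = Q t c (H t w) / prop t c (H t w) &
      prop t c (H t w) * ratio t c (H t w) = Q t c (H t w)].
Proof.
move=> tT; apply: filterS (ae_support tT) => w [].
rewrite /ratio /propw /Qw; set p := pi t _; set f := ff t _ => p0 p1 pf c.
have /andP[f0 f1] := ff01 (H t w) tT; rewrite -/f in f0 f1.
have q0 : 0 <= p + f * (1 - p) by nra.
have q1 : 0 <= 1 - (p + f * (1 - p)) by nra.
case: ifP => _.
  rewrite ger0_norm ?divr_ge0//; split=> //.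
  have [e|ne] := eqVneq p 0; last by rewrite mulrC divfK.
  by rewrite e (pf e); lra.
have p1' : 0 <= 1 - p by lra.
rewrite ger0_norm ?divr_ge0//; split=> //.
have [e|ne] := eqVneq (1 - p) 0; last by rewrite mulrC divfK.
by rewrite e mul0r mulr0 addr0; lra.
Qed.

Section Regime.
Variable b : nat -> bool.

(** The weight of an observed path, restricted to the event that its first [n] treatments are [b].
    The ratio is taken at [b s] rather than at the observed treatment, which is the same on that
    event and leaves a function of H_s beside the indicator. *)
Definition omega n h : R :=
  \prod_(0 <= s < n) ((Aof s h == b s)%:R * ratio s (b s) (histA s h)).

Lemma omega_ge0 n h : 0 <= omega n h.
Proof. by apply: prodr_ge0 => s _; rewrite mulr_ge0// normr_ge0. Qed.

Lemma measurable_omega n : (n <= T)%N -> measurable_fun setT (omega n).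
Proof.
move=> nT; apply: measurable_prod_nat => s /andP[_ sn].
have sT := leq_trans sn nT.
apply: measurable_funM; first by apply: measurable_eqb_natr; exact: measurable_Aof.
apply: (measurableT_comp (measurable_ratio (b s) sT)).
exact: measurable_trunc.
Qed.

Lemma omega_setX k x h : omega k (setXh k x h) = omega k h.
Proof.
by apply: eq_big_nat => s /andP[_ sk]; rewrite histA_setX.
Qed.

Lemma omegaS k w : (k < T)%N -> omega k.+1 (tr w k.+1) =
  omega k (tr w k) * ((fA (pre w k, UA k w) == b k)%:R * ratio k (b k) (pre w k)).
Proof.
move=> kT; rewrite /omega big_nat_recr//=; congr (_ * _).
  apply: eq_big_nat => s /andP[_ sk]; have sT := ltn_trans sk kT.
  have sk1 : (s < k.+1)%N by exact: ltnW.
  rewrite -[setAh _ _ _]/(tr w k.+1) !histA_traj//.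
  by rewrite -[Aof s (tr w k.+1)]/(Aof s (tr w k.+1)) !Aof_traj.
rewrite -[setAh _ _ _]/(tr w k.+1) histA_traj//.
by rewrite Aof_traj.
Qed.

(** Probability, over the uniform at time [k], that the intervention delivers [b k] when the natural
    treatment is [c] and the history is [h]. *)
Definition flip_prob k c h : R :=
  if c == a k then (c == b k)%:R else if b k == a k then ff k h else 1 - ff k h.

Lemma flip_prob_ge0 k c h : (k < T)%N -> 0 <= flip_prob k c h.
Proof.
move=> kT; have /andP[f0 f1] := ff01 h kT; rewrite /flip_prob.
by do 2?case: ifP => // _; rewrite subr_ge0.
Qed.

Lemma measurable_flip_prob k c : (k < T)%N -> measurable_fun setT (flip_prob k c).
Proof.
move=> kT; have mf := mff kT; rewrite /flip_prob.
case: (c == a k); first exact: measurable_cst.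
by case: (b k == a k) => //; exact: measurable_funB.
Qed.

(** Total probability over the natural treatment; this is the origin of the formula for [Q]. *)
Lemma flip_prob_mean k h :
  prop k true h * flip_prob k true h + prop k false h * flip_prob k false h =
  Q k (b k) h.
Proof.
by rewrite /propw /Qw /flip_prob; case: (a k); case: (b k) => /=; ring.
Qed.

Lemma isCondExp_prop k c : (k < T)%N ->
  isCondExp P (\1_[set w | [set z | fA z = c] (H k w, UA k w)]) (H k) (prop k c).
Proof.
move=> kT; have mH := measurable_Hobs kT.
have e c' : [set w | [set z | fA z = c'] (H k w, UA k w)] =
    [set w | Aobs fX fA UX UA k w = c'].
  by apply/seteqP; split => w /=; rewrite AobsE.
rewrite e /propw; have [->|nc] := eqVneq c (a k); first exact: cepi.
have -> : [set w | Aobs fX fA UX UA k w = c] = ~` [set w | Aobs fX fA UX UA k w = a k].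
  by apply/seteqP; split => w /=; case: Aobs c (a k) nc => -[] [] //= _ /(_ erefl).
apply: isCondExp_compl => //; last exact: cepi.
have mA : measurable_fun setT (Aobs fX fA UX UA k).
  by apply: measurable_Aof; exact: measurable_tr.
by rewrite -[X in measurable X]setTI; apply: (mA measurableT [set a k]).
Qed.

Lemma futureU_measurable k : futureU_events T UX UA UY k `<=` measurable.
Proof.
move=> E [[s [B [/andP[_ sT] [mB ->]]]]|[[s [B [/andP[_ sT] [mB ->]]]]|[B [mB ->]]]].
- exact: measurable_preim (mUX sT) mB.
- exact: measurable_preim (mUA sT) mB.
- exact: measurable_preim mUY mB.
Qed.

(** Strong sequential randomization in usable form: [g] may depend on H_k and on every exogenous
    variable after U_{A,k}. *)
Lemma future_weight k c
    (g : hist * g_sigma_algebraType (futureU_events T UX UA UY k) -> \bar R) :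
  (k < T)%N -> measurable_fun setT g ->
  (\int[P]_w (((fA (H k w, UA k w) == c)%:R)%:E * g (H k w, w)) =
   \int[P]_w ((prop k c (H k w))%:E * g (H k w, w)))%E.
Proof.
move=> kT mg.
have mD : measurable [set z | @fA k z = c].
  have mc : measurable [set c] by [].
  exact: (measurable_preim (mfA kT) mc).
rewrite -(condIndep_weight (mUA kT) (measurable_Hobs kT) (@futureU_measurable k)
  mD (rand kT) (isCondExp_prop c kT) mg).
apply: eq_integral => w _; rewrite indicE; congr ((nat_of_bool _)%:R%:E * _)%E.
by apply/idP/idP; [move/eqP => e; exact/mem_set|move/set_mem => /= ->].
Qed.

(** * From forced to observed treatments, one time at a time *)

Section Hybrid.
Variable G : hist * UYT -> \bar R.
Hypotheses (mG : measurable_fun setT G) (G0 : forall z, (0 <= G z)%E).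
Local Notation cont := (continuation fX fA UX UA UY b flip_prob G).

(** The conditional law of the natural treatment is used in both directions with the same [g]:
    forwards to average the flip probability into [Q], backwards to turn [prop] times [ratio] into
    the indicator that the observed treatment is [b k]. *)
Lemma hybrid_step m k : (k + m.+1 <= T)%N ->
  (\int[P]_w ((omega k (tr w k))%:E * cont m.+1 k (tr w k) w) =
   \int[P]_w ((omega k.+1 (tr w k.+1))%:E * cont m k.+1 (tr w k.+1) w))%E.
Proof.
move=> kmT.
have kT : (k < T)%N by apply: leq_trans kmT; rewrite addnS ltnS leq_addr.
have kmT' : (k.+1 + m <= T)%N by rewrite addSnnS.
pose OF : measurableType _ := g_sigma_algebraType (futureU_events T UX UA UY k).
(* Treatment [k] is set to [b k] whatever its natural value, so U_{A,k} no longer occurs: [g]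
   depends on H_k and later noise only. *)
pose g (z : hist * OF) : \bar R :=
  ((omega k z.1)%:E * cont m k.+1 (setAh k (b k) z.1) z.2)%E.
have mcont : measurable_fun setT (fun z : hist * OF => cont m k.+1 z.1 z.2).
  apply: measurable_continuation => //.
  - move=> s /andP[ks sm] _ B mB; rewrite setTI; apply: sub_sigma_algebra.
    by left; exists s, B; rewrite ks (leq_trans sm).
  - move=> s /andP[ks sm] _ B mB; rewrite setTI; apply: sub_sigma_algebra.
    by right; left; exists s, B; rewrite ks (leq_trans sm).
  - move=> _ B mB; rewrite setTI; apply: sub_sigma_algebra.
    by right; right; exists B.
  - by move=> s c sT; exact: measurable_flip_prob.
have mg : measurable_fun setT g.
  apply: emeasurable_funM.
    apply/measurable_EFinP; apply: (measurableT_comp (measurable_omega (ltnW kT))).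
    exact: measurable_fst.
  apply: (@measurableT_comp _ _ _ _ _ _ (fun z : hist * OF => cont m k.+1 z.1 z.2) _
    (fun z : hist * OF => (setAh k (b k) z.1, z.2))) => //.
  by apply: measurable_fun_pair => //; exact: measurable_setAh.
have g0 z : (0 <= g z)%E.
  rewrite mule_ge0 ?lee_fin ?omega_ge0//; apply: continuation_ge0 => // s c h sT.
  exact: flip_prob_ge0.
have mHw : measurable_fun setT (fun w : Omega => (H k w, w : OF)).
  apply: measurable_fun_pair; first exact: measurable_Hobs.
  exact/measurable_id_gsigma/futureU_measurable.
have mgH : measurable_fun setT (fun w => g (H k w, w)) by exact: (measurableT_comp mg mHw).
have mH := measurable_Hobs kT.
have mfg (f : hist -> R) : measurable_fun setT f ->
    measurable_fun setT (fun z : hist * OF => (f z.1)%:E * g z)%E.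
  move=> mf; apply: emeasurable_funM => //; apply/measurable_EFinP.
  by apply: measurableT_comp.
have mfgH (f : hist -> R) : measurable_fun setT f ->
    measurable_fun setT (fun w => (f (H k w))%:E * g (H k w, w))%E.
  by move=> mf; exact: (measurableT_comp (mfg f mf) mHw).
have mA : measurable_fun setT (fun w => @fA k (H k w, UA k w)).
  by apply: (measurableT_comp (mfA kT)); apply: measurable_fun_pair => //; exact: mUA.
transitivity (\int[P]_w ((((fA (H k w, UA k w) == true)%:R)%:E *
     ((flip_prob k true (H k w))%:E * g (H k w, w))) +
    (((fA (H k w, UA k w) == false)%:R)%:E *
     ((flip_prob k false (H k w))%:E * g (H k w, w)))))%E.
  apply: eq_integral => w _; rewrite HobsE// /g /= omega_setX -/(preA _ _ k).
  rewrite muleCA; case: (fA (pre w k, UA k w)) => /=;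
    by rewrite mul1e mul0e ?adde0 ?add0e.
have mb1 c : measurable_fun setT (fun w => (((fA (H k w, UA k w) == c)%:R)%:E *
     ((flip_prob k c (H k w))%:E * g (H k w, w))))%E.
  apply: emeasurable_funM.
    by apply/measurable_EFinP; exact: measurable_eqb_natr.
  by apply: mfgH; exact: measurable_flip_prob.
have fg0 c w : (0 <= (flip_prob k c (H k w))%:E * g (H k w, w))%E.
  by rewrite mule_ge0// lee_fin flip_prob_ge0.
rewrite ge0_integralD//; last 2 first.
- by move=> w _; rewrite mule_ge0// lee_fin.
- by move=> w _; rewrite mule_ge0// lee_fin.
rewrite !(future_weight _ kT (g := fun z => ((flip_prob k _ z.1)%:E * g z)%E)); last 2 first.
- by apply: mfg; exact: measurable_flip_prob.
- by apply: mfg; exact: measurable_flip_prob.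
have aeR := ae_ratio kT.
have mp c := measurable_prop c kT; have mfp c := measurable_flip_prob c kT.
have mpfg (f : hist -> R) c : measurable_fun setT f ->
    measurable_fun setT (fun w => (f (H k w))%:E *
      ((flip_prob k c (H k w))%:E * g (H k w, w)))%E.
  move=> mf; apply: emeasurable_funM; last exact: mfgH.
  by apply/measurable_EFinP; exact: measurableT_comp.
have mnp c : measurable_fun setT (fun h => `|prop k c h|).
  by apply: (measurableT_comp (@normr_measurable R setT)).
(* [prop] is nonnegative almost surely; adding the two integrals calls for integrands nonnegative
   everywhere. *)
have E c : (\int[P]_w ((prop k c (H k w))%:E * ((flip_prob k c (H k w))%:E * g (H k w, w))) =
    \int[P]_w (`|prop k c (H k w)|%:E * ((flip_prob k c (H k w))%:E * g (H k w, w))))%E.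
  apply: integral_ae_congr; [exact: mpfg|exact: mpfg (mnp c)|].
  by apply: filterS aeR => w /(_ c)[p0 _ _ _]; rewrite ger0_norm.
rewrite !E -ge0_integralD//; last 4 first.
- by move=> w _; rewrite mule_ge0// lee_fin.
- exact: mpfg (mnp true).
- by move=> w _; rewrite mule_ge0// lee_fin.
- exact: mpfg (mnp false).
transitivity (\int[P]_w ((Q k (b k) (H k w))%:E * g (H k w, w)))%E.
  apply: integral_ae_congr.
  - by apply: emeasurable_funD; [exact: mpfg (mnp true)|exact: mpfg (mnp false)].
  - by apply: mfgH; exact: measurable_Q.
  - apply: filterS aeR => w hw; have [pt _ _ _] := hw true; have [pf _ _ _] := hw false.
    move: (g (H k w, w)) => y; rewrite !ger0_norm// !muleA -!EFinM -ge0_muleDl ?lee_fin ?mulr_ge0 ?flip_prob_ge0//.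
    by rewrite -EFinD flip_prob_mean.
(* Positivity acts here: without it [Q] need not be a multiple of [prop]. *)
transitivity (\int[P]_w ((prop k (b k) (H k w))%:E *
    ((ratio k (b k) (H k w))%:E * g (H k w, w))))%E.
  apply: integral_ae_congr.
  - by apply: mfgH; exact: measurable_Q.
  - apply: emeasurable_funM; last by apply: mfgH; exact: measurable_ratio.
    by apply/measurable_EFinP; exact: measurableT_comp.
  - by apply: filterS aeR => w /(_ (b k))[_ _ _ e];
    move: (g (H k w, w)) => y; rewrite muleA -EFinM e.
rewrite -(future_weight (b k) kT (g := fun z => ((ratio k (b k) z.1)%:E * g z)%E)); last first.
  by apply: mfg; exact: measurable_ratio.
apply: eq_integral => w _; rewrite omegaS// HobsE// trajS /g [(_, _).1]/= [(_, _).2]/= omega_setX.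
have [->|ne] := eqVneq (fA (pre w k, UA k w)) (b k); last first.
  by rewrite /= mul0r mulr0 !mul0e.
by rewrite mul1e mul1r EFinM muleA [X in (X * _)%E]muleC.
Qed.

Lemma hybrid n : (n <= T)%N ->
  (\int[P]_w cont n 0 hist0 w =
   \int[P]_w ((omega n (tr w n))%:E * G (tr w n, UY w)))%E.
Proof.
move=> nT.
suff h m k : (k + m = n)%N -> (\int[P]_w ((omega k (tr w k))%:E * cont m k (tr w k) w) =
    \int[P]_w ((omega n (tr w n))%:E * G (tr w n, UY w)))%E.
  rewrite -(h n 0%N (add0n n)); apply: eq_integral => w _.
  by rewrite /omega big_geq// mul1e.
elim: m k => [|m IH] k; first by rewrite addn0 => ->.
by move=> kmn; rewrite hybrid_step ?kmn// IH// addSnnS.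
Qed.

End Hybrid.

(** * The iterated integral as a weighted observed mean *)

Section GComputation.
Variable kappa : nat -> R.-pker hist ~> (Xcov R d).
Hypothesis law : forall t, (t < T)%N -> forall B, measurable B ->
  isCondExp P (\1_[set w | Xof t (obs fX fA UX UA w) \in B])
    (HXobs fX fA UX UA t) (fun h => fine (kappa t h B)).
Local Open Scope ereal_scope.

Lemma measurable_setX_pair k (g : hist -> \bar R) : measurable_fun setT g ->
  measurable_fun setT (fun z : hist * Xcov R d => g (setXh k z.2 z.1)).
Proof.
move=> mg; apply: (measurableT_comp mg).
by apply: (@measurable_setXh _ _ _ _ _ k snd fst).
Qed.

(** The weight [omega k] does not involve X_k, so it passes through the inner integral; it is pulled
    out by [integralZl_ge0] because that integral may diverge at exceptional histories. *)
Lemma kappa_step k (g : hist -> \bar R) : (k < T)%N -> measurable_fun setT g ->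
  P.-integrable setT (fun w => (omega k (tr w k))%:E * g (H k w)) ->
  P.-integrable setT (fun w => (omega k (tr w k))%:E *
    \int[kappa k (tr w k)]_x g (setXh k x (tr w k))) /\
  \int[P]_w ((omega k (tr w k))%:E *
    \int[kappa k (tr w k)]_x g (setXh k x (tr w k))) =
  \int[P]_w ((omega k (tr w k))%:E * g (H k w)).
Proof.
move=> kT mg ig.
have CE : HXobs fX fA UX UA k = (fun w => tr w k).
  by apply/funext => w; rewrite HXobsE// ltnW.
have mC : measurable_fun setT (HXobs fX fA UX UA k).
  by rewrite CE; exact: measurable_tr (ltnW kT).
have mX : measurable_fun setT (fun w => Xof k (obs fX fA UX UA w)).
  by apply: measurable_Xof; exact: measurable_tr.
pose f (z : hist * Xcov R d) : \bar R := (omega k z.1)%:E * g (setXh k z.2 z.1).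
have mf : measurable_fun setT f.
  apply: emeasurable_funM; last exact: measurable_setX_pair.
  apply/measurable_EFinP; apply: (measurableT_comp (measurable_omega (ltnW kT))).
  exact: measurable_fst.
have fE w : f (HXobs fX fA UX UA k w, Xof k (obs fX fA UX UA w)) =
    (omega k (tr w k))%:E * g (H k w).
  by rewrite /f /= CE HobsE// Xof_traj.
have := kernel_disintegration_integrable mC mX (law kT) mf.
have -> : (fun w => f (HXobs fX fA UX UA k w, Xof k (obs fX fA UX UA w))) =
    (fun w => (omega k (tr w k))%:E * g (H k w)) by exact/funext.
move=> /(_ ig)[iJ eJ].
have JE w : \int[kappa k (HXobs fX fA UX UA k w)]_x f (HXobs fX fA UX UA k w, x) =
    (omega k (tr w k))%:E * \int[kappa k (tr w k)]_x g (setXh k x (tr w k)).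
  rewrite CE /f /=; apply: integralZl_ge0; first exact: omega_ge0.
  exact: (measurableT_comp (measurable_setX_pair k mg) (pair1_measurable (tr w k))).
split; first by move: iJ; apply: eq_integrable.
by rewrite -eJ; apply: eq_integral => w _; rewrite JE.
Qed.

(** Time [k] is removed in two moves: conditioning on H_k turns the treatment indicator into [prop],
    which with [ratio] makes [Q]; then X_k is integrated against its conditional law. *)
Lemma gint_step k (g : hist -> \bar R) : (k < T)%N -> measurable_fun setT g ->
  P.-integrable setT (fun w => (omega k.+1 (tr w k.+1))%:E * g (tr w k.+1)) ->
  let g' h := \int[kappa k h]_x ((Q k (b k) (setXh k x h))%:E *
                g (setAh k (b k) (setXh k x h))) in
  P.-integrable setT (fun w => (omega k (tr w k))%:E * g' (tr w k)) /\
  \int[P]_w ((omega k (tr w k))%:E * g' (tr w k)) =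
  \int[P]_w ((omega k.+1 (tr w k.+1))%:E * g (tr w k.+1)).
Proof.
move=> kT mg ig g'; have mH := measurable_Hobs kT.
pose g1 h := (Q k (b k) h)%:E * g (setAh k (b k) h).
have msA : measurable_fun setT (fun h => g (setAh k (b k) h)).
  by apply: (measurableT_comp mg); exact: measurable_setAh.
have mg1 : measurable_fun setT g1.
  by apply: emeasurable_funM => //; apply/measurable_EFinP; exact: measurable_Q.
pose psi h := (ratio k (b k) h * omega k h)%:E * g (setAh k (b k) h).
have mrw : measurable_fun setT (fun h => ratio k (b k) h * omega k h)%R.
  apply: measurable_funM; first exact: measurable_ratio.
  exact: measurable_omega (ltnW kT).
have mpsi : measurable_fun setT psi.
  by apply: emeasurable_funM => //; exact/measurable_EFinP.
pose E := [set w | [set z | @fA k z = b k] (H k w, UA k w)].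
have mE : measurable E.
  have mA : measurable_fun setT (fun w => @fA k (H k w, UA k w)).
    by apply: (measurableT_comp (mfA kT)); apply: measurable_fun_pair => //; exact: mUA.
  have mb : measurable [set b k] by [].
  exact: (measurable_preim mA mb).
have ce := isCondExp_prop (b k) kT.
have pE w : (\1_E w)%:E * psi (H k w) = (omega k.+1 (tr w k.+1))%:E * g (tr w k.+1).
  rewrite omegaS// /psi HobsE// trajS omega_setX indicE.
  have -> : (w \in E) = (fA (pre w k, UA k w) == b k).
    apply/idP/idP => [/set_mem|/eqP e]; first by rewrite /E /= HobsE// => ->.
    by apply/mem_set; rewrite /E /= HobsE.
  have [->|ne] := eqVneq (fA (pre w k, UA k w)) (b k).
    by rewrite mul1e mul1r mulrC.
  by rewrite /= mul0r mulr0 !mul0e.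
have aeR := ae_ratio kT.
have aeE : \forall w \ae P, (prop k (b k) (H k w))%:E * psi (H k w) =
    (omega k (tr w k))%:E * g1 (H k w).
  apply: filterS aeR => w /(_ (b k))[_ _ _ e].
  rewrite /psi /g1 !muleA -!EFinM mulrA e HobsE// omega_setX; congr (_%:E * _).
  by rewrite mulrC.
have mpp (f : hist -> \bar R) : measurable_fun setT f ->
    measurable_fun setT (fun w => (prop k (b k) (H k w))%:E * f (H k w)).
  move=> mf; apply: emeasurable_funM; last exact: measurableT_comp.
  apply/measurable_EFinP; apply: measurableT_comp => //; exact: measurable_prop.
have mog : measurable_fun setT (fun w => (omega k (tr w k))%:E * g1 (H k w)).
  apply: emeasurable_funM; last exact: measurableT_comp.
  apply/measurable_EFinP.
  exact: (measurableT_comp (measurable_omega (ltnW kT)) (measurable_tr (ltnW kT))).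
have e1 : \int[P]_w ((omega k (tr w k))%:E * g1 (H k w)) =
    \int[P]_w ((omega k.+1 (tr w k.+1))%:E * g (tr w k.+1)).
  rewrite -(@integral_ae_congr _ _ _ P (fun w => (prop k (b k) (H k w))%:E * psi (H k w)))//;
    last exact: mpp.
  rewrite -(isCondExp_indic mH mE ce mpsi).
  by apply: eq_integral => w _; rewrite pE.
(* The same exchange of indicator and [prop], applied to the absolute value of [psi], carries
   integrability along. *)
have i1 : P.-integrable setT (fun w => (omega k (tr w k))%:E * g1 (H k w)).
  apply/integrableP; split => //.
  have mapsi : measurable_fun setT (fun h => `|psi h|) by exact: measurableT_comp.
  rewrite -(@integral_ae_congr _ _ _ P (fun w => (prop k (b k) (H k w))%:E * `|psi (H k w)|)).
  - rewrite -(isCondExp_indic mH mE ce mapsi).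
    have /integrableP[_] := ig; congr (_ < _); apply: eq_integral => w _.
    by rewrite -pE abseM abse_EFin ger0_norm.
  - exact: mpp mapsi.
  - exact: measurableT_comp.
  - apply: filterS2 aeR aeE => w /(_ (b k))[p0 _ _ _] <-.
    by rewrite [RHS]abseM abse_EFin ger0_norm.
have [i2 e2] := kappa_step kT mg1 i1.
by split => //; rewrite -e1 -e2.
Qed.

Lemma measurable_gint (F : hist -> \bar R) m k : (k + m <= T)%N ->
  measurable_fun setT F -> measurable_fun setT (gint kappa Q b F m k).
Proof.
move=> + mF; elim: m k => //= m IH k kmT.
have kT : (k < T)%N by apply: leq_trans kmT; rewrite addnS ltnS leq_addr.
apply: (measurable_integral_kernel (kappa k) (g := fun z => (Q k (b k) (setXh k z.2 z.1))%:E *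
    gint kappa Q b F m k.+1 (setAh k (b k) (setXh k z.2 z.1)))).
apply: (@measurable_setX_pair k (fun h => (Q k (b k) h)%:E *
  gint kappa Q b F m k.+1 (setAh k (b k) h))).
apply: emeasurable_funM; first by apply/measurable_EFinP; exact: measurable_Q.
apply: (@measurableT_comp _ _ _ _ _ _ (gint kappa Q b F m k.+1) _ (setAh k (b k))).
  by apply: IH; rewrite addSnnS.
exact: measurable_setAh.
Qed.

(** Since [F] is signed, the backward induction carries integrability with the identity. At time 0
    the history is the constant [hist0] and the weight is 1, so the mean is the iterated integral
    itself. *)
Lemma gint_expectation (F : hist -> \bar R) n : (n <= T)%N ->
  measurable_fun setT F ->
  P.-integrable setT (fun w => (omega n (tr w n))%:E * F (tr w n)) ->
  gint kappa Q b F n 0 hist0 = \int[P]_w ((omega n (tr w n))%:E * F (tr w n)).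
Proof.
move=> nT mF iF.
suff h m k : (k + m = n)%N ->
    P.-integrable setT (fun w => (omega k (tr w k))%:E * gint kappa Q b F m k (tr w k)) /\
    \int[P]_w ((omega k (tr w k))%:E * gint kappa Q b F m k (tr w k)) =
    \int[P]_w ((omega n (tr w n))%:E * F (tr w n)).
  have [i0 <-] := h n 0%N (add0n n).
  have e w : (omega 0 (tr w 0))%:E * gint kappa Q b F n 0 (tr w 0) = gint kappa Q b F n 0 hist0.
    by rewrite /omega big_geq// mul1e.
  under eq_integral do rewrite e.
  rewrite [RHS](@integral_cst _ _ _ P setT measurableT).
  by rewrite [X in _ * X](@probability_setT _ _ _ P) mule1.
elim: m k => [|m IH] k; first by rewrite addn0 => ->.
move=> kmn; have kT : (k < T)%N.
  by apply: leq_trans nT; rewrite -kmn addnS ltnS leq_addr.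
have [i1 e1] := IH k.+1 (etrans (addSnnS k m) kmn).
have [|i2 e2] := gint_step kT _ i1.
  by apply: measurable_gint => //; rewrite addSnnS kmn.
by split => //; rewrite -e1 -e2.
Qed.

End GComputation.
End Regime.
End Identification.

(** * Integrating out the uniforms *)

Section UniformThreshold.
Context (R : realType).
Local Open Scope ereal_scope.

Lemma integral_uniform_le (f : R) : (0 <= f <= 1)%R ->
  \int[uniform_prob (@ltr01 R)]_v ((v <= f)%R%:R)%:E = f%:E.
Proof.
move=> /andP[f0 f1].
have e : (fun v : R => ((v <= f)%R%:R)%:E : \bar R) = (fun v => (\1_(`]-oo, f]%classic) v)%:E).
  by apply/funext => v; rewrite indicE; congr ((nat_of_bool _)%:R%:E);
    apply/idP/idP; [move=> h; apply/mem_set; rewrite /= in_itv|move/set_mem; rewrite /= in_itv].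
rewrite e integral_uniform//; last exact/measurable_EFinP/measurable_indic.
rewrite subr0 invr1 mul1e integral_indic//.
rewrite (_ : `]-oo, f] `&` `[0%R, 1%R] = `[0%R, f]%classic); last first.
  apply/seteqP; split => v /=; rewrite !in_itv/=; first by move=> [-> /andP[-> _]].
  by move=> /andP[v0 vf]; rewrite vf v0 (le_trans vf f1).
rewrite /= lebesgue_measure_itv/= lte_fin; case: ltgtP f0 => // [_|<-] _.
  by rewrite sube0.
by [].
Qed.

Lemma integral_uniform_gt (f : R) : (0 <= f <= 1)%R ->
  \int[uniform_prob (@ltr01 R)]_v ((~~ (v <= f)%R)%:R)%:E = (1 - f)%:E.
Proof.
move=> /andP[f0 f1].
have e : (fun v : R => ((~~ (v <= f)%R)%:R)%:E : \bar R) = (fun v => (\1_(`]f, +oo[%classic) v)%:E).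
  by apply/funext => v; rewrite indicE -ltNge; congr ((nat_of_bool _)%:R%:E);
    apply/idP/idP; [move=> h; apply/mem_set; rewrite /= in_itv/= andbT|
                    move/set_mem; rewrite /= in_itv/= andbT].
rewrite e integral_uniform//; last exact/measurable_EFinP/measurable_indic.
rewrite subr0 invr1 mul1e integral_indic//.
rewrite (_ : `]f, +oo[ `&` `[0%R, 1%R] = `]f, 1%R]%classic); last first.
  apply/seteqP; split => v /=; rewrite !in_itv/= ?andbT; first by move=> [-> /andP[_ ->]].
  by move=> /andP[fv v1]; rewrite v1 fv (le_trans f0 (ltW fv)).
rewrite /= lebesgue_measure_itv/= lte_fin; by case: ltgtP f1 => // -> _; rewrite subrr.
Qed.
End UniformThreshold.

(** Exactly one tuple agrees with [al], so the sum over regimes selects the realized one. *)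
Lemma sum_tuple_agree (R : realType) n (al : nat -> bool) (F : n.-tuple bool -> \bar R) :
  (\sum_(bb : n.-tuple bool)
     ((all (fun s => nth false bb s == al s) (iota 0 n))%:R)%:E * F bb =
   F [tuple al i | i < n])%E.
Proof.
rewrite (bigD1 [tuple al i | i < n])//= big1 ?adde0.
  rewrite (_ : all _ _ = true) ?mul1e//; apply/allP => s; rewrite mem_iota/= => sn.
  by rewrite (nth_mktuple _ _ (Ordinal sn)).
move=> bb nb; rewrite (_ : all _ _ = false) ?mul0e//; apply: contraNF nb => /allP h.
apply/eqP/eq_from_tnth => i; rewrite tnth_mktuple (tnth_nth false).
by apply/eqP/h; rewrite mem_iota/=.
Qed.

Section FlipTrajectories.
Context (R : realType) (d T : nat)
  (dO : measure_display) (Omega : measurableType dO) (P : probability Omega R)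
  (dX dA : nat -> measure_display) (dY : measure_display)
  (UXT : forall t, measurableType (dX t)) (UAT : forall t, measurableType (dA t))
  (UYT : measurableType dY).
Local Notation hist := (Hist R d T).
Variables (fX : forall t, (hist * UXT t)%type -> Xcov R d)
  (fA : forall t, (hist * UAT t)%type -> bool)
  (UX : forall t, Omega -> UXT t) (UA : forall t, Omega -> UAT t) (UY : Omega -> UYT)
  (V : nat -> Omega -> R) (a : nat -> bool) (ff : nat -> hist -> R).
Hypotheses (mfX : forall t, (t < T)%N -> measurable_fun setT (@fX t))
  (mfA : forall t, (t < T)%N -> measurable_fun setT (@fA t))
  (mUX : forall t, (t < T)%N -> measurable_fun setT (@UX t))
  (mUA : forall t, (t < T)%N -> measurable_fun setT (@UA t))
  (mUY : measurable_fun setT UY)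
  (mV : forall t, (t < T)%N -> measurable_fun setT (V t))
  (mff : forall t, (t < T)%N -> measurable_fun setT (ff t))
  (ff01 : forall t h, (t < T)%N -> 0 <= ff t h <= 1).
Hypothesis indep : forall (B : nat -> set R), (forall t, measurable (B t)) ->
   forall E, <<s allU_events T UX UA UY >> E ->
   P (E `&` \bigcap_(t in `I_T) (V t @^-1` B t)) =
   (P E * \big[*%E/1%E]_(t < T) uniform_prob (@ltr01 R) (B t))%E.

Local Notation gX w := (fun t h => @fX t (h, @UX t w)).

Definition flip_value t (c : bool) (v f : R) : bool :=
  if c == a t then c else if v <= f then a t else c.

Local Notation gF w := (fun t h => flip_value t (@fA t (h, @UA t w)) (V t w) (ff t h)).
Local Notation act w := (fun s => gF w s (preA (gX w) (gF w) s)).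

Section Regime.
Variable b : nat -> bool.
Local Notation gb := (fun t (_ : hist) => b t).
Local Notation OU := (g_sigma_algebraType (allU_events T UX UA UY)).

(** The rule is evaluated along the forced path [b], whose histories contain no uniforms: factor [s]
    thus depends on [V s] and the exogenous variables only, as [randomization] requires. *)
Definition flip_indic s (z : OU * R) : R :=
  (flip_value s (fA (preA (gX z.1) gb s, UA s z.1)) z.2
     (ff s (preA (gX z.1) gb s)) == b s)%:R.

Lemma flip_indic01 s z : 0 <= flip_indic s z <= 1.
Proof. by rewrite /flip_indic; case: (_ == _); rewrite /= ?ler01 ?lexx. Qed.

(** As long as all earlier values agree with [b], the flip path is the forced path; after the first
    disagreement both sides are 0. *)
Lemma prod_flip_indic n w :
  \prod_(0 <= s < n) flip_indic s (w, V s w) =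
    (all (fun s => b s == act w s) (iota 0 n))%:R.
Proof.
elim: n => [|n IH]; first by rewrite big_geq.
rewrite big_nat_recr// IH.
have -> : iota 0 n.+1 = rcons (iota 0 n) n by rewrite -cats1 -addn1 iotaD.
rewrite all_rcons andbC.
case: allP => [h|_]; last by rewrite /= mulr0n mul0r.
have e : traj (gX w) (gF w) n = traj (gX w) gb n.
  apply: traj_ext => k kn.
  by apply/esym/eqP/(h k); rewrite mem_iota.
rewrite /= mul1r /flip_indic eq_sym.
by rewrite /preA /= e.
Qed.

Lemma allU_measurable : allU_events T UX UA UY `<=` measurable.
Proof.
move=> E [[s [B [sT [mB ->]]]]|[[s [B [sT [mB ->]]]]|[B [mB ->]]]].
- exact: measurable_preim (mUX sT) mB.
- exact: measurable_preim (mUA sT) mB.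
- exact: measurable_preim mUY mB.
Qed.

Lemma allU_UX s : (s < T)%N -> measurable_fun setT (@UX s : OU -> UXT s).
Proof.
move=> sT _ B mB; rewrite setTI; apply: sub_sigma_algebra.
by left; exists s, B.
Qed.

Lemma allU_UA s : (s < T)%N -> measurable_fun setT (@UA s : OU -> UAT s).
Proof.
move=> sT _ B mB; rewrite setTI; apply: sub_sigma_algebra.
by right; left; exists s, B.
Qed.

Lemma allU_UY : measurable_fun setT (UY : OU -> UYT).
Proof.
move=> _ B mB; rewrite setTI; apply: sub_sigma_algebra.
by right; right; exists B.
Qed.

Lemma measurable_flip_indic s : (s < T)%N -> measurable_fun setT (flip_indic s).
Proof.
move=> sT; apply: measurable_eqb_natr.
have mp0 : measurable_fun setT (fun w : OU => preA (gX w) gb s).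
  apply: (@measurable_preA _ _ _ _ _ _ mfX _ OU UX (fun s h w => b s) _ sT) => r rs.
    by apply: allU_UX; exact: leq_ltn_trans sT.
  exact: measurable_cst.
have mp : measurable_fun setT (fun z : OU * R => preA (gX z.1) gb s).
  exact: (measurableT_comp mp0 measurable_fst).
have mc : measurable_fun setT (fun z : OU * R => fA (preA (gX z.1) gb s, UA s z.1)).
  apply: (measurableT_comp (mfA sT)); apply: measurable_fun_pair => //.
  exact: (measurableT_comp (allU_UA sT) measurable_fst).
rewrite /flip_value; apply: measurable_fun_ifT => //.
  rewrite (_ : (fun z => _) = (fun z : OU * R => if fA (preA (gX z.1) gb s, UA s z.1)
    then true == a s else false == a s)); last first.
    by apply/funext => z; case: (fA _).
  by apply: measurable_fun_ifT.
apply: measurable_fun_ifT => //.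
apply: measurable_fun_ler => //.
exact: (measurableT_comp (mff sT) mp).
Qed.

(** The threshold test succeeds with probability f. Treatments being binary, when both the natural
    value and [b s] differ from the target they coincide, so [b s] is delivered when the test
    fails. *)
Lemma mean_flip_indic s w : (s < T)%N ->
  mean_phi (uniform_prob (@ltr01 R)) flip_indic s w =
  flip_prob a ff b s (fA (preA (gX w) gb s, UA s w)) (preA (gX w) gb s).
Proof.
move=> sT; rewrite /mean_phi /flip_indic /flip_value /flip_prob /=.
set c := fA _; set h := preA _ _ _; have f01 := ff01 h sT.
have [ca|nca] := eqVneq c (a s).
  rewrite integral_cst// [X in (_ * X)%E](_ : _ = 1%E) ?mule1//.
  exact: (@probability_setT _ _ _ (uniform_prob (@ltr01 R))).
have [ba|nba] := eqVneq (b s) (a s).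
  rewrite (_ : \int[_]_v _ = (ff s h)%:E)%E// -integral_uniform_le//.
  apply: eq_integral => v _; congr ((nat_of_bool _)%:R%:E); rewrite ba.
  by case: ifP; rewrite ?eqxx ?(negbTE nca).
rewrite (_ : \int[_]_v _ = (1 - ff s h)%:E)%E// -integral_uniform_gt//.
apply: eq_integral => v _; congr ((nat_of_bool _)%:R%:E).
by case: ifP; case: c (a s) (b s) nca nba => -[] [].
Qed.

End Regime.

Lemma flip_expectation n (G : hist * UYT -> \bar R) : (n <= T)%N ->
  measurable_fun setT G -> (forall z, 0 <= G z)%E ->
  (\int[P]_w G (traj (gX w) (gF w) n, UY w) =
   \sum_(bb : n.-tuple bool) \int[P]_w
     continuation fX fA UX UA UY (nth false bb) (flip_prob a ff (nth false bb)) G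
       n 0 hist0 w)%E.
Proof.
move=> nT mG G0.
pose tb (b : nat -> bool) w := traj (gX w) (fun t _ => b t) n.
have mtb b : measurable_fun setT (fun w : g_sigma_algebraType (allU_events T UX UA UY) =>
    G (tb b w, UY w)).
  apply: (measurableT_comp mG); apply: measurable_fun_pair; last exact: allU_UY.
  apply: (@measurable_traj _ _ _ _ _ _ mfX _
    (g_sigma_algebraType (allU_events T UX UA UY)) UX (fun s h w => b s) _ nT) => r rn.
    by apply: allU_UX; exact: leq_trans nT.
  exact: measurable_cst.
have mid := measurable_id_gsigma allU_measurable.
transitivity (\int[P]_w \sum_(bb : n.-tuple bool)
    (((\prod_(0 <= s < n) flip_indic (nth false bb) s (w, V s w)))%:E *
     G (tb (nth false bb) w, UY w)))%E.
  apply: eq_integral => w _.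
  under eq_bigr do rewrite prod_flip_indic.
  rewrite (sum_tuple_agree (act w) (fun bb => G (tb (nth false bb) w, UY w))).
  congr (G (_, _)); apply: traj_ext => k kn.
  by rewrite (nth_mktuple _ _ (Ordinal kn)).
rewrite ge0_integral_sum//; last 2 first.
- move=> bb; apply: emeasurable_funM; last exact: (measurableT_comp (mtb _) mid).
  apply/measurable_EFinP; apply: measurable_prod_nat => s /andP[_ sn].
  have sT := leq_trans sn nT.
  apply: (measurableT_comp (measurable_flip_indic _ sT)).
  by apply: measurable_fun_pair; [exact: mid|exact: mV].
- move=> bb w _; rewrite mule_ge0// lee_fin; apply: prodr_ge0 => s _.
  by have /andP[] := flip_indic01 (nth false bb) s (w, V s w).
apply: eq_bigr => bb _.
rewrite (randomization (nu := uniform_prob (@ltr01 R)) allU_measurable mV (fun t => measurable_flip_indic (nth false bb) (s := t))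
  (flip_indic01 (nth false bb)) indep nT (mtb _) (fun w => G0 _)).
apply: eq_integral => w _.
rewrite (continuation_prod fX fA UX UA UY (nth false bb) _ _ n 0 w) add0n.
congr ((_)%:E * _)%E; apply: eq_big_nat => s /andP[_ sn].
by rewrite mean_flip_indic// (leq_trans sn).
Qed.

End FlipTrajectories.

(** * The weighted observed mean *)

Lemma prod_agree (R : realType) n (al be : nat -> bool) (f : nat -> bool -> R) :
  \prod_(0 <= s < n) ((al s == be s)%:R * f s (be s)) =
  (all (fun s => be s == al s) (iota 0 n))%:R * \prod_(0 <= s < n) f s (be s).
Proof.
elim: n => [|n IH]; first by rewrite !big_geq// mulr1.
rewrite !big_nat_recr// IH.
have -> : iota 0 n.+1 = rcons (iota 0 n) n by rewrite -cats1 -addn1 iotaD.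
rewrite all_rcons [be n == al n]eq_sym.
by case: (al n == be n); case: (all _ _); rewrite /= ?mul0r ?mulr0 ?mul0r ?mul1r.
Qed.

Section Weighting.
Context (R : realType) (d T : nat)
  (dO : measure_display) (Omega : measurableType dO) (P : probability Omega R)
  (dX dA : nat -> measure_display) (dY : measure_display)
  (UXT : forall t, measurableType (dX t)) (UAT : forall t, measurableType (dA t))
  (UYT : measurableType dY).
Local Notation hist := (Hist R d T).
Variables (fX : forall t, (hist * UXT t)%type -> Xcov R d)
  (fA : forall t, (hist * UAT t)%type -> bool)
  (UX : forall t, Omega -> UXT t) (UA : forall t, Omega -> UAT t) (UY : Omega -> UYT)
  (V : nat -> Omega -> R) (a : nat -> bool) (ff : nat -> hist -> R)
  (pi : nat -> hist -> R).
Hypotheses (mfX : forall t, (t < T)%N -> measurable_fun setT (@fX t))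
  (mfA : forall t, (t < T)%N -> measurable_fun setT (@fA t))
  (mUX : forall t, (t < T)%N -> measurable_fun setT (@UX t))
  (mUA : forall t, (t < T)%N -> measurable_fun setT (@UA t))
  (mUY : measurable_fun setT UY)
  (mV : forall t, (t < T)%N -> measurable_fun setT (V t)).
Hypothesis indep : forall (B : nat -> set R), (forall t, measurable (B t)) ->
   forall E, <<s allU_events T UX UA UY >> E ->
   P (E `&` \bigcap_(t in `I_T) (V t @^-1` B t)) =
   (P E * \big[*%E/1%E]_(t < T) uniform_prob (@ltr01 R) (B t))%E.
Hypotheses (mff : forall t, (t < T)%N -> measurable_fun setT (ff t))
  (ff01 : forall t h, (t < T)%N -> 0 <= ff t h <= 1).
Hypothesis rand : forall t, (t < T)%N ->
  condIndep P (@UA t) (futureU_events T UX UA UY t) (Hobs fX fA UX UA t).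
Hypothesis cepi : forall t, (t < T)%N ->
  isCondExp P (\1_[set w | Aobs fX fA UX UA t w = a t])
    (Hobs fX fA UX UA t) (pi t).
Hypothesis positivity : forall t, (t < T)%N ->
     P [set w | pi t (Hobs fX fA UX UA t w) = 0 ->
                ff t (Hobs fX fA UX UA t w) = 0] = 1%E \/
     P [set w | pi t (Hobs fX fA UX UA t w) = 0] = 0%E.

Local Notation Q := (Qw a ff pi).
Local Notation prop := (propw a pi).
Local Notation H := (Hobs fX fA UX UA).
Local Notation A := (Aobs fX fA UX UA).
Local Notation gX w := (fun t h => @fX t (h, @UX t w)).
Local Notation gA w := (fun t h => @fA t (h, @UA t w)).
Local Notation gF w := (fun t h => flip_value a t (@fA t (h, @UA t w)) (V t w) (ff t h)).
Local Notation tr w := (traj (gX w) (gA w)).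
Local Notation om bb := (omega a ff pi (nth false bb)).

Definition weight n w : R := \prod_(0 <= s < n) ratio a ff pi s (A s w) (H s w).

Lemma weight_ge0 n w : 0 <= weight n w.
Proof. by apply: prodr_ge0 => s _; exact: normr_ge0. Qed.

Lemma measurable_weight n : (n <= T)%N -> measurable_fun setT (weight n).
Proof.
move=> nT; apply: measurable_prod_nat => s /andP[_ sn].
have sT := leq_trans sn nT; have mH := measurable_Hobs mfX mfA mUX mUA sT.
rewrite (_ : (fun w => _) = (fun w => if A s w then ratio a ff pi s true (H s w)
    else ratio a ff pi s false (H s w))); last first.
  by apply/funext => w; case: (A s w).
apply: measurable_fun_ifT.
- by apply: measurable_Aof; exact: (measurable_tr mfX mfA mUX mUA (leqnn T)).
- exact: (measurableT_comp (measurable_ratio mff cepi true sT) mH).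
- exact: (measurableT_comp (measurable_ratio mff cepi false sT) mH).
Qed.

Lemma omega_trE n (bb : n.-tuple bool) w : (n <= T)%N -> om bb n (tr w n) =
  (all (fun s => nth false bb s == A s w) (iota 0 n))%:R *
  \prod_(0 <= s < n) ratio a ff pi s (nth false bb s) (H s w).
Proof.
move=> nT.
rewrite -(prod_agree n (fun s => A s w) (nth false bb) (fun s c => ratio a ff pi s c (H s w))).
apply: eq_big_nat => s /andP[_ sn]; have sT := leq_trans sn nT.
by rewrite HobsE// histA_traj// Aof_traj// AobsE// HobsE.
Qed.

Lemma sum_omega n w : (n <= T)%N ->
  \sum_(bb : n.-tuple bool) om bb n (tr w n) = weight n w.
Proof.
move=> nT; apply: EFin_inj; rewrite -sumEFin.
under eq_bigr do rewrite omega_trE// EFinM.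
rewrite (sum_tuple_agree (fun s => A s w) (fun bb : n.-tuple bool =>
  (\prod_(0 <= s < n) ratio a ff pi s (nth false bb s) (H s w))%:E)).
congr EFin; apply: eq_big_nat => s /andP[_ sn].
by rewrite (nth_mktuple _ _ (Ordinal sn)).
Qed.

Lemma omega_le_weight n (bb : n.-tuple bool) w : (n <= T)%N ->
  om bb n (tr w n) <= weight n w.
Proof.
move=> nT; rewrite -sum_omega// (bigD1 bb)//= lerDl sumr_ge0// => i _.
exact: omega_ge0.
Qed.

Lemma ae_weight n : (n <= T)%N -> \forall w \ae P,
  weight n w = \prod_(s < n) (Q s (A s w) (H s w) / prop s (A s w) (H s w)).
Proof.
elim: n => [|n IH] nT; first by apply: aeW => w; rewrite /weight big_geq// big_ord0.
have h := ae_ratio mfX mfA mUX mUA mff ff01 cepi positivity nT.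
apply: filterS2 (IH (ltnW nT)) h => w IHw /(_ (A n w))[_ _ e _].
by rewrite /weight big_nat_recr//= -/(weight n w) IHw e big_ord_recr.
Qed.

Lemma flip_identity n (G : hist * UYT -> \bar R) : (n <= T)%N ->
  measurable_fun setT G -> (forall z, 0 <= G z)%E ->
  (\int[P]_w G (traj (gX w) (gF w) n, UY w) =
   \int[P]_w ((weight n w)%:E * G (tr w n, UY w)))%E.
Proof.
move=> nT mG G0.
rewrite (flip_expectation a mfX mfA mUX mUA mUY mV mff ff01 indep nT mG G0).
under eq_bigr do rewrite (hybrid mfX mfA mUX mUA mUY mff ff01 rand cepi positivity _ mG G0 nT).
rewrite -ge0_integral_sum//; last 2 first.
- move=> bb; apply: emeasurable_funM.
    apply/measurable_EFinP.
    exact: (measurableT_comp (measurable_omega mff cepi _ nT) (measurable_tr mfX mfA mUX mUA nT)).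
  apply: (measurableT_comp mG); apply: measurable_fun_pair => //.
  exact: (measurable_tr mfX mfA mUX mUA nT).
- by move=> bb w _; rewrite mule_ge0// lee_fin omega_ge0.
apply: eq_integral => w _; rewrite -sum_omega// -sumEFin ge0_sume_distrl//.
by move=> bb _; rewrite lee_fin omega_ge0.
Qed.

(** The weight is nonnegative, so positive and negative parts correspond on the two sides and the
    equality covers infinite integrals. *)
Lemma flip_identity_signed n (g : hist * UYT -> R) : (n <= T)%N ->
  measurable_fun setT g ->
  (\int[P]_w (g (traj (gX w) (gF w) n, UY w))%:E =
   \int[P]_w (weight n w * g (tr w n, UY w))%:E)%E.
Proof.
move=> nT mg; have mgE : measurable_fun setT (fun z => (g z)%:E) by exact/measurable_EFinP.
under [RHS]eq_integral do rewrite EFinM.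
rewrite [RHS](integral_ge0_weight P (fun w => (g (tr w n, UY w))%:E) (weight_ge0 n)).
rewrite [LHS]integralE; congr (_ - _)%E.
  transitivity (\int[P]_w (fun z => (g z)%:E)^\+ (traj (gX w) (gF w) n, UY w))%E.
    by apply: eq_integral => w _; rewrite !funeposE.
  rewrite flip_identity//; last exact: measurable_funepos.
  by apply: eq_integral => w _; rewrite !funeposE.
transitivity (\int[P]_w (fun z => (g z)%:E)^\- (traj (gX w) (gF w) n, UY w))%E.
  by apply: eq_integral => w _; rewrite !funenegE.
rewrite flip_identity//; last exact: measurable_funeneg.
by apply: eq_integral => w _; rewrite !funenegE.
Qed.

(** The nonnegative identity for the absolute value of [g] transfers integrability from the
    interventional to the weighted observed outcome. *)
Lemma flip_integrable n (g : hist * UYT -> R) : (n <= T)%N ->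
  measurable_fun setT g ->
  P.-integrable setT (fun w => (g (traj (gX w) (gF w) n, UY w))%:E) ->
  P.-integrable setT (fun w => (weight n w * g (tr w n, UY w))%:E).
Proof.
move=> nT mg /integrableP[_ ig].
have mgt : measurable_fun setT (fun w => g (tr w n, UY w)).
  apply: (measurableT_comp mg); apply: measurable_fun_pair => //.
  exact: (measurable_tr mfX mfA mUX mUA nT).
apply/integrableP; split.
  apply/measurable_EFinP; apply: measurable_funM => //.
  exact: measurable_weight.
have mga : measurable_fun setT (fun z => (`|g z|)%:E).
  apply/measurable_EFinP; exact: (measurableT_comp (@normr_measurable R setT)).
have := flip_identity nT mga (fun z => _ : (0 <= `|g z|%:E)%E).
move=> /(_ (fun z => normr_ge0 (g z))) e.
move: ig; under eq_integral do rewrite abse_EFin; rewrite e.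
congr (_ < _)%E; apply: eq_integral => w _.
by rewrite abse_EFin normrM ger0_norm ?weight_ge0// EFinM.
Qed.

(** [weight n] as a function of H_n, so that it can multiply a test function when conditioning on
    H_n. *)
Definition hist_weight n h : R :=
  \prod_(0 <= s < n) ratio a ff pi s (Aof s h) (histA s h).

Lemma weight_hist n w : (n < T)%N -> weight n w = hist_weight n (H n w).
Proof.
move=> nT; apply: eq_big_nat => s /andP[_ sn]; have sT := ltn_trans sn nT.
rewrite AobsE// !HobsE// histA_setX// histA_traj//.
by rewrite -[Aof s _]/(Aof s (tr w n)) Aof_traj.
Qed.

Lemma measurable_hist_weight n : (n <= T)%N -> measurable_fun setT (hist_weight n).
Proof.
move=> nT; apply: measurable_prod_nat => s /andP[_ sn].
have sT := leq_trans sn nT.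
have mh : measurable_fun setT (fun h : hist => histA s h) by exact: measurable_trunc.
rewrite (_ : (fun h => _) = (fun h => if Aof s h then ratio a ff pi s true (histA s h)
    else ratio a ff pi s false (histA s h))); last first.
  by apply/funext => h; case: (Aof s h).
apply: measurable_fun_ifT; first exact: measurable_Aof.
- exact: (measurableT_comp (measurable_ratio mff cepi true sT) mh).
- exact: (measurableT_comp (measurable_ratio mff cepi false sT) mh).
Qed.

(** The value of D_t is settled after [t.+1] stages, so the identity is applied there instead of at
    [T]; the weight still contains the factor of time [t]. *)
Lemma flip_treatment_weight t : (t < T)%N ->
  (\int[P]_w ((nat_of_bool (Dflip fX fA UX UA V a ff t w))%:R : R)%:E =
   \int[P]_w (weight t.+1 w * (A t w)%:R)%:E)%E.
Proof.
move=> tT.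
pose g (z : hist * UYT) : R := (Aof t z.1 == true)%:R.
have mg : measurable_fun setT g.
  by apply: measurable_eqb_natr; exact: measurable_Aof.
transitivity (\int[P]_w (g (traj (gX w) (gF w) t.+1, UY w))%:E)%E.
  apply: eq_integral => w _; rewrite /g eqb_id; congr ((nat_of_bool _)%:R%:E).
  rewrite [RHS]Aof_traj//.
  exact: (Aof_traj (gX w) (gF w)).
rewrite flip_identity_signed//; apply: eq_integral => w _.
rewrite /g eqb_id; congr (_ * (nat_of_bool _)%:R)%:E.
by rewrite AobsE// HobsE// -[LHS]/(Aof t (tr w t.+1)) Aof_traj.
Qed.

(** For the constant outcome 1 the identity says that the weight has mean 1, which bounds the mean
    of a binary treatment. *)
Lemma flip_treatment_lty t : (t < T)%N ->
  (\int[P]_w ((nat_of_bool (Dflip fX fA UX UA V a ff t w))%:R : R)%:E < +oo)%E.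
Proof.
move=> tT; rewrite flip_treatment_weight//.
have := flip_identity_signed tT (g := fun=> 1) (measurable_cst _).
rewrite [LHS](@integral_cst _ _ _ P setT measurableT) mul1e [LHS](@probability_setT _ _ _ P) => e.
apply: (@le_lt_trans _ _ 1%E); last exact: ltry.
have mw := measurable_weight tT.
rewrite e; apply: ge0_le_integral => //.
- by move=> w _; rewrite lee_fin mulr_ge0// weight_ge0.
- apply/measurable_EFinP; apply: measurable_funM => //.
  under eq_fun do rewrite -[A t _]eqb_id.
  by apply: measurable_eqb_natr; apply: measurable_Aof;
    exact: (measurable_tr mfX mfA mUX mUA (leqnn T)).
- by apply/measurable_EFinP; exact: measurable_funM.
- move=> w _; rewrite lee_fin ler_wpM2l ?weight_ge0//.
  by case: (A t w); rewrite /= ?ler01 ?lexx.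
Qed.

(** Conditioning on H_t replaces the indicator of treatment 1 by [prop], which absorbs the last
    ratio into [Q]. *)
Lemma flip_treatment_mean t : (t < T)%N ->
  (\int[P]_w ((nat_of_bool (Dflip fX fA UX UA V a ff t w))%:R : R)%:E =
   \int[P]_w (Q t true (H t w) * weight t w)%:E)%E.
Proof.
move=> tT; have mH := measurable_Hobs mfX mfA mUX mUA tT.
rewrite flip_treatment_weight//.
pose E := [set w | [set z | @fA t z = true] (H t w, UA t w)].
have mE : measurable E.
  have mA : measurable_fun setT (fun w => @fA t (H t w, UA t w)).
    by apply: (measurableT_comp (mfA tT)); apply: measurable_fun_pair => //; exact: mUA.
  have mb : measurable [set true] by [].
  exact: (measurable_preim mA mb).
pose psi h := (ratio a ff pi t true h * hist_weight t h)%:E.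
have mpsi : measurable_fun setT psi.
  apply/measurable_EFinP; apply: measurable_funM; last exact: measurable_hist_weight (ltnW tT).
  exact: (measurable_ratio mff cepi true tT).
transitivity (\int[P]_w ((\1_E w)%:E * psi (H t w)))%E.
  apply: eq_integral => w _; rewrite -EFinM; congr EFin.
  rewrite /weight big_nat_recr//= -/(weight t w) weight_hist// AobsE// indicE.
  have -> : (w \in E) = fA (H t w, UA t w).
    by apply/idP/idP => [/set_mem //|e]; exact/mem_set.
  by case: (fA _) => /=; rewrite ?mulr0 ?mul0r// mulr1 mul1r mulrC.
rewrite (isCondExp_indic mH mE (isCondExp_prop mfX mfA mUX mUA cepi true tT) mpsi).
have mQ := measurable_Q mff cepi true tT.
have mp := measurable_prop cepi true tT.
apply: integral_ae_congr.
- by apply: emeasurable_funM; [apply/measurable_EFinP; exact: measurableT_comp|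
    exact: measurableT_comp].
- apply/measurable_EFinP; apply: measurable_funM; first exact: measurableT_comp.
  exact: measurable_weight (ltnW tT).
have h := ae_ratio mfX mfA mUX mUA mff ff01 cepi positivity tT.
apply: filterS h => w /(_ true)[_ _ _ e].
by rewrite /psi -EFinM mulrA e weight_hist.
Qed.

End Weighting.

(** * The identities for the outcome and for each treatment *)

Theorem theorem1 (R : realType) (d T : nat)
  (dO : measure_display) (Omega : measurableType dO) (P : probability Omega R)
  (dX dA : nat -> measure_display) (dY : measure_display)
  (UXT : forall t, measurableType (dX t)) (UAT : forall t, measurableType (dA t))
  (UYT : measurableType dY)
  (* structural model *)
  (fX : forall t, (Hist R d T * UXT t)%type -> Xcov R d)
  (fA : forall t, (Hist R d T * UAT t)%type -> bool)
  (fY : (Hist R d T * UYT)%type -> R)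
  (UX : forall t, Omega -> UXT t) (UA : forall t, Omega -> UAT t) (UY : Omega -> UYT)
  (* flip intervention: uniforms, target regime, weight functions *)
  (V : nat -> Omega -> R) (a : nat -> bool) (ff : nat -> Hist R d T -> R)
  (* versions of the observed-data nuisance functions *)
  (pi : nat -> Hist R d T -> R)
  (m : Hist R d T -> R)
  (kappa : nat -> R.-pker (Hist R d T) ~> (Xcov R d)) :
  (* measurability of the structural model *)
  (forall t, (t < T)%N -> measurable_fun setT (fX t)) ->
  (forall t, (t < T)%N -> measurable_fun setT (fA t)) ->
  measurable_fun setT fY ->
  (forall t, (t < T)%N -> measurable_fun setT (UX t)) ->
  (forall t, (t < T)%N -> measurable_fun setT (UA t)) ->
  measurable_fun setT UY ->
  (* V_1..V_T iid Unif(0,1), independent of all other variables *)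
  (forall t, (t < T)%N -> measurable_fun setT (V t)) ->
  (forall (B : nat -> set R), (forall t, measurable (B t)) ->
   forall E, <<s allU_events T UX UA UY >> E ->
   P (E `&` \bigcap_(t in `I_T) (V t @^-1` B t)) =
   (P E * \big[*%E/1%E]_(t < T) uniform_prob (@ltr01 R) (B t))%E) ->
  (* weight functions f_t : histories -> [0,1] *)
  (forall t, (t < T)%N -> measurable_fun setT (ff t)) ->
  (forall t h, (t < T)%N -> 0 <= ff t h <= 1) ->
  (* strong sequential randomization *)
  (forall t, (t < T)%N ->
     condIndep P (UA t) (futureU_events T UX UA UY t)
       (Hobs fX fA UX UA t)) ->
  (* pi t is a version of P(A_t = a_t | H_t) *)
  (forall t, (t < T)%N ->
     isCondExp P (\1_[set w | Aobs fX fA UX UA t w = a t])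
       (Hobs fX fA UX UA t) (pi t)) ->
  (* m is a version of E(Y | A_T-bar, X_T-bar) *)
  isCondExp P (Yobs fX fA fY UX UA UY) (obs fX fA UX UA) m ->
  (* kappa t is a version of the conditional law of X_t given (A_{t-1}, H_{t-1}) *)
  (forall t, (t < T)%N -> forall B, measurable B ->
     isCondExp P (\1_[set w | Xof t (obs fX fA UX UA w) \in B])
       (HXobs fX fA UX UA t) (fun h => fine (kappa t h B))) ->
  (* positivity: for every t, (1) or (2) *)
  (forall t, (t < T)%N ->
     P [set w | pi t (Hobs fX fA UX UA t w) = 0 ->
                ff t (Hobs fX fA UX UA t w) = 0] = 1%E \/
     P [set w | pi t (Hobs fX fA UX UA t w) = 0] = 0%E) ->
  (* expectations involved exist *)
  P.-integrable setT (EFin \o Yobs fX fA fY UX UA UY) ->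
  P.-integrable setT (EFin \o Yflip fX fA fY UX UA UY V a ff) ->
  let Q := Qw a ff pi in
  let prop := propw a pi in
  let H := Hobs fX fA UX UA in
  let A := Aobs fX fA UX UA in
  [/\ (\int[P]_w (Yflip fX fA fY UX UA UY V a ff w)%:E =
        \sum_(bb : T.-tuple bool)
           gint kappa Q (fun s => nth false bb s) (fun h => (m h)%:E) T 0 hist0)%E,
      (\int[P]_w (Yflip fX fA fY UX UA UY V a ff w)%:E =
        \int[P]_w (Yobs fX fA fY UX UA UY w *
                   \prod_(s < T) (Q s (A s w) (H s w) / prop s (A s w) (H s w)))%:E)%E,
      (forall t, (t < T)%N ->
        \int[P]_w ((nat_of_bool (Dflip fX fA UX UA V a ff t w))%:R : R)%:E =
        \sum_(bb : t.-tuple bool)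
           gint kappa Q (fun s => nth false bb s)
             (fun h => \int[kappa t h]_x (Q t true (setXh t x h))%:E) t 0 hist0)%E &
      (forall t, (t < T)%N ->
        \int[P]_w ((nat_of_bool (Dflip fX fA UX UA V a ff t w))%:R : R)%:E =
        \int[P]_w (Q t true (H t w) *
                   \prod_(s < t) (Q s (A s w) (H s w) / prop s (A s w) (H s w)))%:E)%E].
Proof.
move=> mfX mfA mfY mUX mUA mUY mV indep mff ff01 rand cepi cem law posit iY iYf Q prop H A.
pose W n w := weight fX fA UX UA a ff pi n w.
pose om (bb : nat -> bool) n h := omega a ff pi bb n h.
pose tr w n := traj (fun t h => fX t (h, UX t w)) (fun t h => fA t (h, UA t w)) n.
have mtr n : (n <= T)%N -> measurable_fun setT (tr^~ n).
  by move=> nT; exact: (measurable_tr mfX mfA mUX mUA nT).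
have mom bb n : (n <= T)%N -> measurable_fun setT (fun w => om bb n (tr w n)).
  by move=> nT; exact: (measurableT_comp (measurable_omega mff cepi bb nT) (mtr n nT)).
have om0 bb n h : 0 <= om bb n h by exact: omega_ge0.
have W0 n w : 0 <= W n w by exact: weight_ge0.
have omW n (bb : n.-tuple bool) w : (n <= T)%N -> om (nth false bb) n (tr w n) <= W n w.
  by move=> nT; exact: omega_le_weight.
have sumW n w : (n <= T)%N ->
    \sum_(bb : n.-tuple bool) om (nth false bb) n (tr w n) = W n w.
  by move=> nT; exact: sum_omega.
have mW n : (n <= T)%N -> measurable_fun setT (W n).
  by move=> nT; exact: (measurable_weight mfX mfA mUX mUA mff cepi nT).
have aeW n : (n <= T)%N -> \forall w \ae P,
    W n w = \prod_(s < n) (Q s (A s w) (H s w) / prop s (A s w) (H s w)).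
  by move=> nT; exact: (ae_weight mfX mfA mUX mUA mff ff01 cepi posit nT).
have mprod n : (n <= T)%N -> measurable_fun setT
    (fun w => \prod_(s < n) (Q s (A s w) (H s w) / prop s (A s w) (H s w))).
  move=> nT; under eq_fun do rewrite -(big_mkord xpredT (fun s =>
    Q s (A s _) (H s _) / prop s (A s _) (H s _))).
  apply: measurable_prod_nat => s /andP[_ sn]; have sT := leq_trans sn nT.
  have mH := measurable_Hobs mfX mfA mUX mUA sT.
  have mq c : measurable_fun setT (fun w => Q s c (H s w) / prop s c (H s w)).
    apply: measurable_funM.
      exact: (measurableT_comp (measurable_Q mff cepi c sT) mH).
    apply: (@measurableT_comp _ _ _ _ _ _ (@GRing.inv R) _ (fun w => prop s c (H s w))).
      exact: measurable_invr.
    exact: (measurableT_comp (measurable_prop cepi c sT) mH).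
  rewrite (_ : (fun w => _) = (fun w => if A s w then Q s true (H s w) / prop s true (H s w)
     else Q s false (H s w) / prop s false (H s w))); last first.
    by apply/funext => w; case: (A s w).
  apply: measurable_fun_ifT => //.
  by apply: measurable_Aof; exact: (mtr T (leqnn T)).
have Y2 : (\int[P]_w (Yflip fX fA fY UX UA UY V a ff w)%:E =
    \int[P]_w (W T w * Yobs fX fA fY UX UA UY w)%:E)%E.
  exact: (flip_identity_signed mfX mfA mUX mUA mUY mV indep mff ff01 rand cepi posit
    (leqnn T) mfY).
have iWY : P.-integrable setT (fun w => (W T w * Yobs fX fA fY UX UA UY w)%:E).
  exact: (flip_integrable mfX mfA mUX mUA mUY mV indep mff ff01 rand cepi posit
    (leqnn T) mfY iYf).
have mY : measurable_fun setT (Yobs fX fA fY UX UA UY).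
  by apply: (measurableT_comp mfY); apply: measurable_fun_pair => //; exact: mtr T (leqnn T).
have Dmean t (tT : (t < T)%N) := flip_treatment_mean mfX mfA mUX mUA mUY mV indep mff ff01
  rand cepi posit tT.
have mQH t : (t < T)%N -> measurable_fun setT (fun w => Q t true (H t w)).
  move=> tT; exact: (measurableT_comp (measurable_Q mff cepi true tT)
    (measurable_Hobs mfX mfA mUX mUA tT)).
split.
- rewrite Y2.
  (* Each [om] is one nonnegative summand of [W], so domination makes every term integrable and the
     finite sum leaves the integral. *)
  have iYb (bb : T.-tuple bool) : P.-integrable setT (fun w =>
      (Yobs fX fA fY UX UA UY w * om (nth false bb) T (obs fX fA UX UA w))%:E).
    move: iWY; apply: le_integrable => //.
      by apply/measurable_EFinP; apply: measurable_funM => //; exact: mom (leqnn T).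
    move=> w _; rewrite !abse_EFin lee_fin mulrC !normrM ler_wpM2r//.
    by rewrite !ger0_norm//; exact: omW.
  transitivity (\int[P]_w \sum_(bb : T.-tuple bool)
      (Yobs fX fA fY UX UA UY w * om (nth false bb) T (obs fX fA UX UA w))%:E)%E.
    apply: eq_integral => w _; rewrite sumEFin; congr EFin.
    by rewrite /W -sum_omega// mulrC mulr_sumr.
  rewrite integral_sum//; apply: eq_bigr => bb _.
  have [mm _] := cem.
  (* The weight is a function of the full observed history, so [Y] may be replaced by its
     conditional mean [m] despite the weight being unbounded. *)
  have [im em] := isCondExp_weight (mtr T (leqnn T)) cem iY
    (measurable_omega mff cepi (nth false bb) (leqnn T)) (om0 (nth false bb) T) (iYb bb).
  rewrite (gint_expectation mfX mfA mUX mUA mff ff01 cepi posit law (leqnn T)).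
  + by rewrite -em; apply: eq_integral => w _; rewrite -EFinM mulrC.
  + exact/measurable_EFinP.
  + by move: im; apply: eq_integrable => // w _; rewrite -EFinM mulrC.
- rewrite Y2; apply: integral_ae_congr.
  + by apply/measurable_EFinP; apply: measurable_funM => //; exact: mW.
  + by apply/measurable_EFinP; apply: measurable_funM => //; exact: mprod.
  + by apply: filterS (aeW T (leqnn T)) => w ->; rewrite mulrC.
- move=> t tT.
  have tT' := ltnW tT.
  (* The integrand is almost surely nonnegative and its integral is the mean of a binary
     variable. *)
  have iQW : P.-integrable setT (fun w => (Q t true (H t w) * W t w)%:E).
    apply/integrableP; split.
      apply/measurable_EFinP; apply: measurable_funM; [exact: mQH|exact: mW].
    rewrite (@integral_ae_congr _ _ _ P _ (fun w => (Q t true (H t w) * W t w)%:E)).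
    + rewrite -Dmean//.
      exact: (flip_treatment_lty mfX mfA mUX mUA mUY mV indep mff ff01 rand cepi posit tT).
    + apply: measurableT_comp => //; apply/measurable_EFinP.
      by apply: measurable_funM; [exact: mQH|exact: mW].
    + by apply/measurable_EFinP; apply: measurable_funM; [exact: mQH|exact: mW].
    + have h := ae_ratio mfX mfA mUX mUA mff ff01 cepi posit tT.
      apply: filterS h => w /(_ true)[_ q0 _ _].
      by rewrite abse_EFin ger0_norm// mulr_ge0.
  rewrite Dmean//.
  have iQb (bb : t.-tuple bool) : P.-integrable setT (fun w =>
      ((om (nth false bb) t (tr w t))%:E * (Q t true (H t w))%:E)%E).
    move: iQW; apply: le_integrable => //.
      by apply: emeasurable_funM; apply/measurable_EFinP; [exact: mom|exact: mQH].
    move=> w _; rewrite -EFinM !abse_EFin lee_fin mulrC !normrM ler_wpM2l//.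
    by rewrite !ger0_norm//; exact: omW.
  transitivity (\int[P]_w \sum_(bb : t.-tuple bool)
      ((om (nth false bb) t (tr w t))%:E * (Q t true (H t w))%:E))%E.
    apply: eq_integral => w _; rewrite /= -ge0_sume_distrl; last by move=> *; rewrite lee_fin.
    by rewrite sumEFin sumW// -EFinM mulrC.
  rewrite integral_sum//; apply: eq_bigr => bb _.
  have mQt : measurable_fun setT (fun h => (Q t true h)%:E).
    by apply/measurable_EFinP; exact: (measurable_Q mff cepi true tT).
  (* Time [t] contributes a covariate but no treatment to sum over: X_t is integrated separately,
     before the [t] earlier stages are handled by [gint]. *)
  have [ik ek] := kappa_step mfX mfA mUX mUA mff cepi law tT mQt (iQb bb).
  rewrite (gint_expectation mfX mfA mUX mUA mff ff01 cepi posit law tT' _ ik)//.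
  apply: (measurable_integral_kernel (kappa t) (g := fun z => (Q t true (setXh t z.2 z.1))%:E)).
  exact: (measurable_setX_pair t mQt).
- move=> t tT; have tT' := ltnW tT; rewrite Dmean//; apply: integral_ae_congr.
  + by apply/measurable_EFinP; apply: measurable_funM; [exact: mQH|exact: mW].
  + by apply/measurable_EFinP; apply: measurable_funM; [exact: mQH|exact: mprod].
  + by apply: filterS (aeW t tT') => w /= <-.
Qed.
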